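(* Let $0<\varepsilon\le1$ and $C>0$ be constants. Let $A=(a_{ij})$ be an $n\times n$ real symmetric matrix with $\rho_q(A)\ge n^{-C}$. Then there exist a set $I_0$ of size $O_{C,\varepsilon}(1)$, a set $I$ of size at least $n-2n^{\varepsilon}$ with $I\cap I_0=\emptyset$, a nonzero integer $k$ and integers $k_{ii_0}$ ($i_0\in I_0$, $i\in I$), all of absolute value at most $n^{O_{C,\varepsilon}(1)}$, such that, with $R$ the $n\times n$ matrix defined by ($R(ij)=k_{ij}$ if $i\in I, j\in I_0$; $R(ii)=k$ if $i\in I$; $R(ij)=0$ for other $j$ when $i\in I$; and the $i$-th row of $R$ equal to the $i$-th standard basis vector when $i\notin I$), the matrix $A'=RAR^{T}$ has the following properties: (i) for each $i\in I$ there exist a set of $n-n^{\varepsilon}$ entries of the $i$-th row of $A'$ and a proper symmetric GAP $Q_i$ of rank $O_{C,\varepsilon}(1)$ and size $n^{O_{C,\varepsilon}(1)}$ containing them; (ii) for each $j\in I$ there exist a set of $n-n^{\varepsilon}$ entries of the $j$-th column of $A'$ and a proper symmetric GAP $P_j$ of rank $O_{C,\varepsilon}(1)$ and size $n^{O_{C,\varepsilon}(1)}$ containing them.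
   Context: $\rho_q(A):=\sup_{a\in\mathbb{R}}\mathbb{P}(\sum_{i,j}a_{ij}x_ix_j=a)$ where $x_1,\dots,x_n$ are independent random variables taking values $\pm1$ with probability $1/2$ each. A symmetric GAP of rank $r$ is $\{m_1g_1+\dots+m_rg_r: m_h\in\mathbb{Z}, |m_h|\le N_h\}$ with real $g_h$, nonnegative integers $N_h$; proper means unique representation; size means cardinality. $O_{C,\varepsilon}(1)$ denotes a quantity bounded by a constant depending only on $C,\varepsilon$; asymptotics are as $n\to\infty$. *)

(* Defs.v *)
From HB Require Import structures.
From mathcomp Require Import all_boot all_order all_algebra.
From mathcomp Require Import all_classical all_reals all_analysis.

Set Implicit Arguments.
Unset Strict Implicit.
Unset Printing Implicit Defensive.

Import Order.TTheory GRing.Theory Num.Theory.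
Import numFieldNormedType.Exports.

Local Open Scope classical_set_scope.
Local Open Scope ring_scope.

Definition mutually_independent (R : realType) (d : measure_display)
    (T : measurableType d) (P : probability T R) (n : nat)
    (x : 'I_n -> {RV P >-> R}) : Prop :=
  forall (J : {set 'I_n}) (B : 'I_n -> set R),
    (forall i, measurable (B i)) ->
    P (\bigcap_(i in [set` J]) (x i @^-1` B i)) =
    (\prod_(i in J) P (x i @^-1` B i))%E.

Definition rademacher (R : realType) (d : measure_display)
    (T : measurableType d) (P : probability T R) (X : {RV P >-> R}) : Prop :=
  P [set t | X t = 1] = (2^-1)%:E /\ P [set t | X t = -1] = (2^-1)%:E.

(* The value depends on [x] only through its joint law, so for independent
   Rademacher variables it depends on [A] alone. *)
Definition rho_q (R : realType) (d : measure_display)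
    (T : measurableType d) (P : probability T R) (n : nat)
    (x : 'I_n -> {RV P >-> R}) (A : 'M[R]_n) : \bar R :=
  ereal_sup (range (fun a : R =>
    P [set t | \sum_(i < n) \sum_(j < n) A i j * x i t * x j t = a])).

Record symgap (R : realType) (r : nat) := SymGap {
  gap_gen : 'I_r -> R;
  gap_bound : 'I_r -> nat }.

Definition gap_box (R : realType) (r : nat) (Q : symgap R r)
    (m : 'I_r -> int) : Prop :=
  forall h : 'I_r, (`|m h| <= gap_bound Q h)%N.

Definition gap_eval (R : realType) (r : nat) (Q : symgap R r)
    (m : 'I_r -> int) : R :=
  \sum_(h < r) (m h)%:~R * gap_gen Q h.

Definition gap_set (R : realType) (r : nat) (Q : symgap R r) : set R :=
  [set y | exists2 m : 'I_r -> int, gap_box Q m & y = gap_eval Q m].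

Definition gap_proper (R : realType) (r : nat) (Q : symgap R r) : Prop :=
  forall m m' : 'I_r -> int, gap_box Q m -> gap_box Q m' ->
    gap_eval Q m = gap_eval Q m' -> m =1 m'.

Definition row_op_mx (R : realType) (n : nat) (I I0 : {set 'I_n})
    (k : int) (kc : 'I_n -> 'I_n -> int) : 'M[R]_n :=
  \matrix_(i, j)
    if i \in I then
      if j \in I0 then (kc i j)%:~R else if j == i then k%:~R else 0
    else (j == i)%:R.

(* [v] lists the entries of a row or column; a "set of n - n^eps entries" is
   a set [S] of at least that many positions. *)
Definition mostly_in_gap (R : realType) (n : nat) (eps : R) (K : nat)
    (v : 'I_n -> R) : Prop :=
  exists (S : {set 'I_n}) (r : nat) (Q : symgap R r),
    [/\ n%:R - n%:R `^ eps <= #|S|%:R,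
        (r <= K)%N,
        gap_proper Q,
        (gap_set Q #<= `I_(n ^ K)%N)%card
      & forall j : 'I_n, j \in S -> gap_set Q (v j)].

(* Main.v *)
Require Import Defs.
From HB Require Import structures.
From mathcomp Require Import all_boot all_order all_algebra.
From mathcomp Require Import ring zify.
From mathcomp Require Import boolp.

Set Implicit Arguments.
Unset Strict Implicit.
Unset Printing Implicit Defensive.

Import Order.TTheory GRing.Theory Num.Theory.

Local Open Scope ring_scope.

(** Let [N] be a power of 2 with [N ^ 2 <= n ^ eps] and [n] polynomial in [N].

    Linear inverse theorem.  Write [b] and [b'] for independent uniform 0-1 vectors.
    If [P (sum_j v_j (b_j - b'_j) = 0) >= N ^ - c], then all but
    [O (N log N)] of the [v_j] satisfy [D v_j = sum_h m_h v_(g h)] with one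
    polynomially bounded [D], [O (c)] fixed indices [g h] and polynomially bounded [m_h].
    To prove this, pick greedily [x_1, x_2, ...] among the [v_j], each [x_i] being used
    with a multiplicity [t_i <= N] for which no [u x_i] with [0 < u <= 2 t_i] lies in the
    box [{sum_(j < i) m_j x_j : |m_j| <= 2 t_j}].  Cauchy-Schwarz allows [N]
    steps to be replaced by [N] copies of one of them without decreasing the probability,
    while each [x_i] costs a factor [(2 t_i + 1) ^ (- 1 / 2)].  Hence
    [prod (2 t_i + 1) <= N ^ (2 c)]: there are [O (log N)] elements [x_i], at most [2 c]
    of them have [t_i = N], and each of the others has a multiple by some
    [u_i <= 2 t_i + 2] in the previous box, so it can be eliminated at the cost of
    multiplying the denominator by [u_i].

    Quadratic forms.  For every set [U] of indices, decoupling gives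
    [P (sum_(i in U, j notin U) A_ij (a_i - a'_i) (b_j - b'_j) = 0) >= N ^ - O(1)].
    By the linear theorem in [b, b'], for many [(U, a, a')] the partial column sums satisfy
    [D]-relations, and by pigeonhole [D] and the indices [g h] do not depend on
    [(U, a, a')].  A random [U] misses any large set of indices in many places, so for most
    [j] such a relation holds with fixed coefficients for many [(U, a, a')].  Then
    [D A_j - sum_h q_h A_(g h)] is a vector whose restriction to many [U] is again
    concentrated, so a second application of the linear theorem puts most of its entries in
    one progression. *)

(** * Lazy random walks *)

Section Walks.
Variable R : comPzRingType.
Implicit Types (vs X Y S : seq R) (x y v : R).

Fixpoint subset_sums vs : seq R :=
  if vs is v :: vs' then subset_sums vs' ++ [seq v + x | x <- subset_sums vs']
  else [:: 0].

Lemma big_subset_sums_cons (F : R -> nat) v vs :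
  (\sum_(a <- subset_sums (v :: vs)) F a =
   \sum_(a <- subset_sums vs) F a + \sum_(a <- subset_sums vs) F (v + a)%R)%N.
Proof. by rewrite /= big_cat big_map. Qed.

Lemma big_subset_sums_cat (F : R -> nat) X Y :
  (\sum_(a <- subset_sums (X ++ Y)) F a =
   \sum_(x <- subset_sums X) \sum_(y <- subset_sums Y) F (x + y)%R)%N.
Proof.
elim: X F => [|v X IH] F.
  by rewrite big_seq1; apply: eq_bigr => y _; rewrite add0r.
rewrite cat_cons !big_subset_sums_cons !IH; congr (_ + _)%N.
by apply: eq_bigr => x _; apply: eq_bigr => y _; rewrite addrA.
Qed.

Lemma big_subset_sums_catCA (F : R -> nat) X Y S :
  (\sum_(a <- subset_sums (X ++ Y ++ S)) F a =
   \sum_(a <- subset_sums (Y ++ X ++ S)) F a)%N.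
Proof.
rewrite !big_subset_sums_cat.
transitivity (\sum_(x <- subset_sums X) \sum_(y <- subset_sums Y)
                \sum_(s <- subset_sums S) F (x + (y + s))%R)%N.
  by apply: eq_bigr => x _; rewrite big_subset_sums_cat.
rewrite exchange_big; apply: eq_bigr => y _ /=.
rewrite big_subset_sums_cat; apply: eq_bigr => x _.
by apply: eq_bigr => s _; rewrite addrCA.
Qed.

Lemma big_subset_sums_perm (F : R -> nat) X Y : perm_eq X Y ->
  (\sum_(a <- subset_sums X) F a = \sum_(a <- subset_sums Y) F a)%N.
Proof.
move=> XY.
apply: (@catCA_perm_ind _ (fun Z => _ = \sum_(a <- subset_sums Z) F a)%N _ _ _ XY erefl).
by move=> s1 s2 s3 ->; apply: big_subset_sums_catCA.
Qed.

(** The inner product of the multiplicity functions of two lists. *)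
Definition matches (s t : seq R) : nat := \sum_(a <- s) \sum_(b <- t) (a == b)%R.

Lemma matches_count (u s t : seq R) : uniq u -> {subset s <= u} ->
  matches s t = (\sum_(z <- u) (\sum_(a <- s) (z == a)) * (\sum_(b <- t) (z == b)))%N.
Proof.
move=> uu su; rewrite /matches.
under [RHS]eq_bigr do rewrite big_distrl /=.
rewrite [RHS]exchange_big /=; apply: eq_big_seq => a /su au.
rewrite [RHS](bigD1_seq a) //= eqxx mul1n [X in (_ + X)%N]big1 ?addn0 // => z /negbTE ->.
by rewrite mul0n.
Qed.

Lemma matches_AMGM (s t : seq R) : (2 * matches s t <= matches s s + matches t t)%N.
Proof.
have uu := undup_uniq (s ++ t).
have su : {subset s <= undup (s ++ t)} by move=> a; rewrite mem_undup mem_cat => ->.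
have tu : {subset t <= undup (s ++ t)}.
  by move=> a; rewrite mem_undup mem_cat orbC => ->.
rewrite !(matches_count _ uu) // big_distrr -big_split /=.
by apply: leq_sum => z _; apply: nat_Cauchy.
Qed.

(** This is [4 ^ size vs] times the probability that a lazy walk ends at [x]; its step along [v] is
    [0] with probability 1/2 and [v] or [- v] with probability 1/4 each. *)
Definition cnt vs x : nat :=
  \sum_(a <- subset_sums vs) \sum_(b <- subset_sums vs) (a == b + x)%R.

Lemma cnt_perm X Y x : perm_eq X Y -> cnt X x = cnt Y x.
Proof.
move=> XY; rewrite /cnt (big_subset_sums_perm _ XY).
by apply: eq_bigr => a _; apply: big_subset_sums_perm.
Qed.

(** An autocorrelation is largest at the origin: AM-GM for the subset sums and their translate by
    [x]. *)
Lemma cnt_le0 vs x : (cnt vs x <= cnt vs 0)%N.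
Proof.
set s := subset_sums vs.
have -> : cnt vs x = matches s [seq b + x | b <- s].
  by rewrite /matches; apply: eq_bigr => a _; rewrite big_map.
have -> : cnt vs 0 = matches s s.
  by apply: eq_bigr => a _; apply: eq_bigr => b _; rewrite addr0.
have -> : matches s s = matches [seq b + x | b <- s] [seq b + x | b <- s].
  rewrite /matches big_map; apply: eq_bigr => a _; rewrite big_map.
  by apply: eq_bigr => b _; rewrite (inj_eq (addIr x)).
have := matches_AMGM s [seq b + x | b <- s].
have -> : matches s s = matches [seq b + x | b <- s] [seq b + x | b <- s].
  rewrite /matches big_map; apply: eq_bigr => a _; rewrite big_map.
  by apply: eq_bigr => b _; rewrite (inj_eq (addIr x)).
lia.
Qed.

Lemma cnt_cons v vs x :
  cnt (v :: vs) x = (2 * cnt vs x + cnt vs (x - v)%R + cnt vs (x + v)%R)%N.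
Proof.
rewrite /cnt big_subset_sums_cons.
have E (F G H : R -> nat) : (forall a, F a = G a + H a)%N ->
  (\sum_(a <- subset_sums vs) F a = \sum_(a <- subset_sums vs) G a +
     \sum_(a <- subset_sums vs) H a)%N.
  by move=> FGH; rewrite -big_split; apply: eq_bigr.
rewrite !(E _ _ _ (fun a => big_subset_sums_cons _ _ _)).
have -> : (\sum_(a <- subset_sums vs) \sum_(b <- subset_sums vs) (a == v + b + x)%R =
   \sum_(a <- subset_sums vs) \sum_(b <- subset_sums vs) (a == b + (x + v))%R)%N.
  by apply: eq_bigr => a _; apply: eq_bigr => b _; rewrite -addrA addrC -!addrA.
have -> : (\sum_(a <- subset_sums vs) \sum_(b <- subset_sums vs) (v + a == v + b + x)%R =
   \sum_(a <- subset_sums vs) \sum_(b <- subset_sums vs) (a == b + x)%R)%N.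
  by apply: eq_bigr => a _; apply: eq_bigr => b _; rewrite -addrA (inj_eq (addrI v)).
have -> : (\sum_(a <- subset_sums vs) \sum_(b <- subset_sums vs) (v + a == b + x)%R =
   \sum_(a <- subset_sums vs) \sum_(b <- subset_sums vs) (a == b + (x - v))%R)%N.
  apply: eq_bigr => a _; apply: eq_bigr => b _.
  by rewrite addrA [v + a]addrC eq_sym -subr_eq eq_sym.
lia.
Qed.

Lemma cnt_cons0 v vs : (cnt (v :: vs) 0 <= 4 * cnt vs 0)%N.
Proof.
rewrite cnt_cons; have := cnt_le0 vs (0 - v)%R; have := cnt_le0 vs (0 + v)%R.
set p := cnt _ (_ - _); set q := cnt _ (_ + _); lia.
Qed.

Lemma cnt_cat0 X vs : (cnt (X ++ vs) 0 <= 4 ^ size X * cnt vs 0)%N.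
Proof.
elim: X => [|v X IH] /=; first by rewrite mul1n.
apply: (leq_trans (cnt_cons0 _ _)).
by rewrite expnS -mulnA leq_pmul2l.
Qed.

(** Moving terms across the equality separates [X] from [Y]: each side is a difference of subset
    sums of one of them plus a subset sum of [S]. AM-GM then applies. *)
Lemma cnt_mix X Y S :
  (2 * cnt (X ++ Y ++ S) 0 <= cnt (X ++ X ++ S) 0 + cnt (Y ++ Y ++ S) 0)%N.
Proof.
pose P Z := [seq z.1 - z.2 + s | z <- [seq (a, b) | a <- subset_sums Z, b <- subset_sums Z],
                         s <- subset_sums S].
have big_P Z (F : R -> nat) : (\sum_(p <- P Z) F p =
   \sum_(a <- subset_sums Z) \sum_(b <- subset_sums Z) \sum_(s <- subset_sums S)
     F (a - b + s)%R)%N.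
  by rewrite /P !big_allpairs_dep.
have E Z T : cnt (Z ++ T ++ S) 0 = matches (P Z) (P T).
  rewrite /matches big_P /cnt big_subset_sums_cat.
  transitivity (\sum_(a <- subset_sums Z) \sum_(d <- subset_sums T)
     \sum_(s <- subset_sums S)
     \sum_(b <- subset_sums Z) \sum_(c <- subset_sums T) \sum_(s' <- subset_sums S)
      (a + (d + s) == b + (c + s') + 0)%R)%N.
    apply: eq_bigr => a _; rewrite big_subset_sums_cat.
    apply: eq_bigr => d _; apply: eq_bigr => s _; rewrite big_subset_sums_cat.
    by apply: eq_bigr => b _; rewrite big_subset_sums_cat.
  apply: eq_bigr => a _.
  transitivity (\sum_(b <- subset_sums Z) \sum_(s <- subset_sums S)
     \sum_(d <- subset_sums T) \sum_(c <- subset_sums T) \sum_(s' <- subset_sums S)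
      (a + (d + s) == b + (c + s') + 0)%R)%N.
    rewrite exchange_big /= [RHS]exchange_big; apply: eq_bigr => s _ /=.
    by rewrite exchange_big.
  apply: eq_bigr => b _; apply: eq_bigr => s _; rewrite big_P exchange_big /=.
  apply: eq_bigr => c _; apply: eq_bigr => d _; apply: eq_bigr => s' _.
  congr (nat_of_bool _).
  rewrite -subr_eq0 -[RHS]subr_eq0; congr (_ == _); ring.
rewrite !E; exact: matches_AMGM.
Qed.

(* Hoelder's inequality for the (nonnegative) characteristic functions of the
   lazy steps, in the weak form that the largest factor dominates. *)
Lemma cnt_block l vs S : size vs = (2 ^ l)%N ->
  exists2 v, v \in vs & (cnt (vs ++ S) 0 <= cnt (nseq (2 ^ l) v ++ S) 0)%N.
Proof.
elim: l vs S => [|l IH] vs S.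
  by case: vs => [|v [|]] //= _; exists v; rewrite ?mem_head.
move=> szvs; have szl : (2 ^ l.+1 = 2 ^ l + 2 ^ l)%N by rewrite expnS mul2n addnn.
set X := take (2 ^ l) vs; set Y := drop (2 ^ l) vs.
have sX : size X = (2 ^ l)%N by rewrite size_take szvs szl -[X in (X < _)%N]addn0 ltn_add2l expn_gt0.
have sY : size Y = (2 ^ l)%N by rewrite size_drop szvs szl addnK.
have [v vX le1] := IH X (Y ++ S) sX.
have [w wY le2] := IH Y (nseq (2 ^ l) v ++ S) sY.
have {}le1 : (cnt (vs ++ S) 0 <= cnt (nseq (2 ^ l) w ++ nseq (2 ^ l) v ++ S) 0)%N.
  apply: leq_trans le2; rewrite -(cat_take_drop (2 ^ l) vs) -catA.
  by apply: (leq_trans le1); rewrite (cnt_perm _ (permEl (perm_catCA _ _ _))).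
have := cnt_mix (nseq (2 ^ l) w) (nseq (2 ^ l) v) S.
rewrite !catA -!nseqD -!szl -!catA => mix.
have max_le (a b c d : nat) : (a <= b -> 2 * b <= c + d -> d <= c -> a <= c)%N by lia.
case/orP: (leq_total (cnt (nseq (2 ^ l.+1) v ++ S) 0) (cnt (nseq (2 ^ l.+1) w ++ S) 0)).
  by exists w; [exact: mem_drop wY | exact: max_le mix _].
by exists v; [exact: mem_take vX | rewrite addnC in mix; exact: max_le mix _].
Qed.

(** One lazy step is, up to a shift by [v], the operator [f x + f (x - v)] applied twice; hence the
    binomial coefficients of order [2 * t] and the recentring by [v *+ t]. *)
Lemma cnt_nseq t v vs x :
  cnt (nseq t v ++ vs) x =
  (\sum_(m < (2 * t).+1) 'C(2 * t, m) * cnt vs (x + v *+ t - v *+ m)%R)%N.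
Proof.
pose T (f : R -> nat) x := (f x + f (x - v)%R)%N.
have iterT k (f : R -> nat) y :
    iter k T f y = (\sum_(m < k.+1) 'C(k, m) * f (y - v *+ m)%R)%N.
  elim: k y => [|k IH] y; first by rewrite big_ord1 bin0 mul1n mulr0n subr0.
  rewrite iterS /T !IH big_ord_recl [RHS]big_ord_recl !bin0 !mul1n -addnA; congr (_ + _)%N.
  under [RHS]eq_bigr do rewrite lift0 binS mulnDl.
  rewrite big_split /= [in RHS]big_ord_recr /= bin_small // mul0n addn0.
  congr (_ + _)%N.
  by apply: eq_bigr => m _; rewrite mulrS opprD addrA.
rewrite -iterT; elim: t x => [|t IH] x; first by rewrite mulr0n addr0.
have -> : nseq t.+1 v ++ vs = v :: (nseq t v ++ vs) by [].
rewrite cnt_cons !IH.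
rewrite (_ : (2 * t.+1 = (2 * t).+2)%N) ?mulnS //.
rewrite !iterS /T mulrS.
rewrite (_ : x + (v + v *+ t) = x + v + v *+ t) ?addrA //.
rewrite (_ : x + v + v *+ t - v = x + v *+ t); last by ring.
rewrite (_ : x - v + v *+ t = x + v *+ t - v); last by ring.
lia.
Qed.

End Walks.

(** * Greedy chains *)

Lemma leq_bin_central t m : ('C(2 * t, m) <= 'C(2 * t, t))%N.
Proof.
have step i : (i < t)%N -> ('C(2 * t, i) <= 'C(2 * t, i.+1))%N.
  move=> it; rewrite -(@leq_pmul2l i.+1) // mul_bin_left.
  by apply: leq_mul => //; lia.
have low i : (i <= t -> 'C(2 * t, i) <= 'C(2 * t, t))%N.
  move=> it; rewrite -(subKn it); elim: (t - i)%N (leq_subr i t) => [|d IH] dt.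
    by rewrite subn0.
  apply: leq_trans (IH (ltnW dt)).
  by rewrite (_ : t - d = (t - d.+1).+1)%N; [apply: step; lia | lia].
have [mt|mt] := leqP m t; first exact: low.
have [m2|m2] := leqP m (2 * t); last by rewrite bin_small.
by rewrite -bin_sub //; apply: low; lia.
Qed.

(** Consecutive central coefficients have ratio [2 (2t + 1) / (t + 1)], and
    [4 (2t + 1) (2t + 3) <= 16 (t + 1) ^ 2]. *)
Lemma central_bin_sq t : ('C(2 * t, t) ^ 2 * (2 * t + 1) <= 16 ^ t)%N.
Proof.
elim: t => [|t IH]; first by rewrite bin0.
have E : (t.+1 * 'C(2 * t.+1, t.+1) = 2 * (2 * t + 1) * 'C(2 * t, t))%N.
  have h1 := mul_bin_diag (2 * t).+1 t.
  have h3 : ('C(2 * t.+1, t.+1) = 'C((2 * t).+1, t.+1) + 'C((2 * t).+1, t))%N.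
    by rewrite mulnS binS.
  have h5 : 'C((2 * t).+1, t) = 'C((2 * t).+1, t.+1).
    by rewrite -bin_sub; [congr binomial; lia | lia].
  by rewrite h3 h5 addnn -mul2n mulnCA -h1 /= addn1 mulnA.
rewrite -(@leq_pmul2l (t.+1 ^ 2)) // mulnA -expnMn E expnMn.
rewrite (_ : 16 ^ t.+1 = 16 * 16 ^ t)%N; last by rewrite expnS.
move: IH; set C := ('C(_, _) ^ 2)%N; set S := (16 ^ t)%N => IH.
apply: (@leq_trans (16 * t.+1 ^ 2 * (C * (2 * t + 1)))%N); last first.
  by rewrite -mulnA mulnCA !leq_mul2l IH !orbT.
rewrite (_ : (2 * (2 * t + 1)) ^ 2 * C * (2 * t.+1 + 1) =
   4 * (2 * t + 1) * (2 * t + 3) * (C * (2 * t + 1)))%N; last by ring.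
by rewrite leq_mul2r; apply/orP; right; lia.
Qed.

Section Chains.
Variable R : comPzRingType.
Implicit Types (ch : seq (R * nat)) (x y : R) (B : nat -> nat).

(** A pair is an element with its multiplicity. Letting the bound [B] depend on the multiplicity
    covers boxes as well as, with [B] constant, combinations of bounded height. *)
Fixpoint lin B ch y : Prop :=
  if ch is p :: ch' then exists2 m : int, (`|m| <= B p.2)%N & lin B ch' (y - p.1 *~ m)
  else y = 0.

Lemma lin_mono B B' ch y : (forall t, B t <= B' t)%N -> lin B ch y -> lin B' ch y.
Proof.
move=> BB; elim: ch y => //= p ch IH y [m mB /IH ly].
by exists m => //; apply: leq_trans (BB _).
Qed.

Lemma lin_add B B' ch y y' : lin B ch y -> lin B' ch y' ->
  lin (fun t => B t + B' t)%N ch (y + y').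
Proof.
elim: ch y y' => [|p ch IH] y y' /= ; first by move=> -> ->; rewrite addr0.
move=> [m mB ly] [m' mB' ly']; exists (m + m'); first by lia.
rewrite (_ : _ - _ = (y - p.1 *~ m) + (y' - p.1 *~ m')); first exact: IH.
by rewrite mulrzDr; ring.
Qed.

Lemma lin_scale B ch y (m : int) : lin B ch y ->
  lin (fun t => `|m| * B t)%N ch (y *~ m).
Proof.
elim: ch y => [|p ch IH] y /=; first by move=> ->; rewrite mul0rz.
move=> [m' mB ly]; exists (m' * m).
  by rewrite abszM mulnC leq_mul.
by rewrite mulrzA -mulrzBl; exact: IH.
Qed.

(** The walk on [flat ch] is supported in the half box; differences of its points lie in the box. *)
Definition halfbox := lin id.
Definition box := lin (fun t => 2 * t)%N.

Lemma box_sub ch y y' : halfbox ch y -> halfbox ch y' -> box ch (y - y').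
Proof.
move=> ly /(@lin_scale _ _ _ (-1)) ly'.
have := lin_add ly ly'; rewrite mulrN1z; apply: lin_mono => t /=; lia.
Qed.

Definition flat ch : seq R := flatten [seq nseq p.2 p.1 | p <- ch].

Lemma size_flat ch : size (flat ch) = (\sum_(p <- ch) p.2)%N.
Proof.
by rewrite size_flatten /shape -map_comp sumnE big_map; under eq_bigr do rewrite /= size_nseq.
Qed.

Lemma cnt_flat_gt0 ch y : (0 < cnt (flat ch) y)%N -> halfbox ch y.
Proof.
elim: ch y => [|[x t] ch IH] y.
  by rewrite /cnt !big_seq1 add0r /=; case: eqP => [<-|].
rewrite /flat /= cnt_nseq lt0n sum_nat_eq0 => /forallPn [m] /=.
rewrite muln_eq0 negb_or => /andP [_]; rewrite -lt0n => /IH h.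
have mt := ltn_ord m.
exists ((m : nat)%:Z - t%:Z); first by rewrite /=; lia.
rewrite mulrzBr /= (_ : y - _ = y + x *+ t - x *+ m) //.
by rewrite -!pmulrn; ring.
Qed.

(** The newest element comes first and is tested against the box of the older ones. The third clause
    tells why its multiplicity stopped growing: it reached the cap [N], or one of the next two
    multiples falls in the box. *)
Fixpoint chain N ch : Prop :=
  if ch is p :: ch' then
    [/\ (0 < p.2)%N,
        forall u, (0 < u <= 2 * p.2)%N -> ~ box ch' (p.1 *+ u),
        p.2 = N \/ exists2 u, (0 < u <= 2 * p.2 + 2)%N & box ch' (p.1 *+ u)
      & chain N ch']
  else True.

(** Two values of [m] with nonzero count would put a short multiple of [x] in the box, which the
    chain forbids. So one binomial coefficient survives per element. *)
Lemma cnt_chain N ch y : chain N ch ->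
  (cnt (flat ch) y <= \prod_(p <- ch) 'C(2 * p.2, p.2))%N.
Proof.
elim: ch y => [|[x t] ch IH] y.
  by move=> _; rewrite /cnt !big_seq1 add0r big_nil; case: eqP.
case=> /= t_gt0 nbox _ ch_ok; rewrite /flat /= cnt_nseq big_cons /=.
pose F (m : 'I_(2 * t).+1) := cnt (flat ch) (y + x *+ t - x *+ m).
have one (m m' : 'I_(2 * t).+1) : (m < m')%N -> (0 < F m)%N -> (0 < F m')%N -> False.
  move=> mm' /cnt_flat_gt0 Fm /cnt_flat_gt0 Fm'.
  apply: (nbox (m' - m)%N); first by have := ltn_ord m'; lia.
  rewrite mulrnBr; last exact: ltnW.
  by have := box_sub Fm Fm'; rewrite (_ : _ - _ = x *+ m' - x *+ m) //; ring.
have [m0 Fm0|F0] := pickP (fun m => 0 < F m)%N; last first.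
  rewrite big1 // => m _; have := F0 m; rewrite /F lt0n => /negbFE/eqP ->.
  by rewrite muln0.
rewrite (bigD1 m0) //= big1 ?addn0.
  by apply: leq_mul; [exact: leq_bin_central | exact: IH].
move=> m; rewrite neq_ltn => mm0; apply/eqP; rewrite muln_eq0 orbC -leqn0 leqNgt.
apply/orP; left; apply/negP => Fm.
by case/orP: mm0 => [/one|/one]; apply.
Qed.

Definition vol ch : nat := \prod_(p <- ch) (2 * p.2 + 1).

(** By [cnt_chain] and [central_bin_sq], [cnt ^ 2 * vol] is at most [16 ^ size], hence at most
    [cnt ^ 2 * q ^ 2]. *)
Lemma vol_le N ch q : chain N ch -> (4 ^ size (flat ch) <= cnt (flat ch) 0 * q)%N ->
  (vol ch <= q ^ 2)%N.
Proof.
move=> ch_ok le1.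
have le2 : (cnt (flat ch) 0 ^ 2 * vol ch <= 16 ^ size (flat ch))%N.
  apply: (@leq_trans ((\prod_(p <- ch) 'C(2 * p.2, p.2)) ^ 2 * vol ch)%N).
    by rewrite leq_mul2r leq_exp2r // (cnt_chain _ ch_ok) orbT.
  rewrite size_flat expn_sum -mulnn -!big_split /=; apply: leq_prod => p _.
  by rewrite mulnn central_bin_sq.
have c_gt0 : (0 < cnt (flat ch) 0)%N.
  by rewrite lt0n; apply: contraTneq le1 => ->; rewrite mul0n -ltnNge expn_gt0.
rewrite -(@leq_pmul2l (cnt (flat ch) 0 ^ 2)) ?expn_gt0 ?c_gt0 //.
apply: (leq_trans le2); rewrite -expnMn (_ : 16 = 4 ^ 2)%N // -expnM mulnC expnM.
by rewrite leq_exp2r.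
Qed.

Lemma vol_gt0 ch : (0 < vol ch)%N.
Proof. by rewrite /vol prodn_gt0 // => p; rewrite addn1. Qed.

Lemma expn_size_le_vol N ch : chain N ch -> (2 ^ size ch <= vol ch)%N.
Proof.
rewrite /vol; elim: ch => [|p ch IH] /=; first by rewrite big_nil.
by case=> p0 _ _ /IH le1; rewrite big_cons expnS leq_mul // addn1; lia.
Qed.

Definition big_part N ch := [seq p <- ch | p.2 == N].

Lemma expn_big_part_le_vol N ch : (N ^ size (big_part N ch) <= vol ch)%N.
Proof.
rewrite /vol; elim: ch => [|p ch IH] /=; first by rewrite big_nil.
rewrite big_cons; case: eqP => [->|_] /=.
  by rewrite expnS leq_mul // addn1; lia.
by apply: (leq_trans IH); rewrite leq_pmull // addn1.
Qed.

(* A small step gives [u x = y'] with [y'] in the previous box, so the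
   denominator is multiplied by [u] and the coefficients by [2 t + u]. *)
Lemma box_denominator N ch : (0 < N)%N -> chain N ch ->
  exists2 D, (0 < D <= vol ch ^ 2)%N &
    forall y, box ch y -> lin (fun=> 2 * N * vol ch ^ 2)%N (big_part N ch) (y *+ D).
Proof.
move=> N_gt0; elim: ch => [|[x t] ch IH].
  by move=> _; exists 1%N; rewrite /vol ?big_nil // => y /= ->.
case=> /= t_gt0 _ t_or ch_ok; have [D /andP [D_gt0 leD] boxD] := IH ch_ok.
have volE : vol ((x, t) :: ch) = ((2 * t + 1) * vol ch)%N by rewrite /vol big_cons.
have v0 := vol_gt0 ch; set V := vol ch in v0 leD boxD volE *; rewrite volE.
case: eqP => [tN|tN].
  exists D; first by rewrite D_gt0 expnMn (leq_trans leD) // leq_pmull // expn_gt0 addn1.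
  move=> y [m /= mt /boxD ly]; exists (m * D%:Z) => /=.
    rewrite abszM absz_nat expnMn; nia.
  rewrite mulrzA -pmulrn -mulrnBl; apply: lin_mono ly => _.
  by rewrite leq_mul // expnMn leq_pmull // expn_gt0 addn1.
case: t_or => // -[u /andP [u_gt0 ut] /boxD lu].
exists (D * u)%N.
  by rewrite muln_gt0 D_gt0 u_gt0 /= expnMn mulnC leq_mul //; nia.
move=> y [m /= mt /boxD ly].
have -> : y *+ (D * u) = (x *+ u *+ D) *~ m + ((y - x *~ m) *+ D) *~ u%:Z.
  have -> : x *+ u *+ D *~ m = x *~ m *+ (D * u)%N.
    rewrite !pmulrn -!mulrzA; congr (x *~ _); rewrite PoszM.
    by move: (u%:Z) (D%:Z) => a b; ring.
  by rewrite -pmulrn -mulrnA mulrnBl addrCA subrr addr0.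
apply: lin_mono (lin_add (lin_scale m lu) (lin_scale u%:Z ly)) => _ /=.
rewrite ?absz_nat -mulnDl expnMn (mulnCA (2 * N)%N) leq_mul //; nia.
Qed.

Lemma lin_cat_ex B ch y (I : Type) (v : I -> R) (J : seq I) (i0 : I) :
  [seq p.1 | p <- ch] = map v J -> lin B ch y ->
  exists2 m : nat -> int,
    (forall h, h < size J -> exists2 p, p \in [seq p.2 | p <- ch] & `|m h| <= B p)%N
    & y = \sum_(h < size J) v (nth i0 J h) *~ m h.
Proof.
elim: ch J y => [|[x t] ch IH] [|j J] y //=; first by exists (fun=> 0); rewrite ?big_ord0.
case=> -> chJ [m mt /(IH _ _ chJ) [ms msB yE]].
exists (fun h => if h is h'.+1 then ms h' else m).
  case=> [_|h hJ]; first by exists t; rewrite ?mem_head.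
  by have [p pch le1] := msB h hJ; exists p; rewrite // inE pch orbT.
by rewrite big_ord_recl /= -(subrK (v j *~ m) y) yE addrC.
Qed.

End Chains.

Section Greedy.
Variables (R : comPzRingType) (I : eqType) (v : I -> R).
Implicit Types (ch : seq (R * nat)) (rest : seq I).

(** Excluding [2x] as well as [x] makes the first multiple in the box at least the third, so a
    positive multiplicity is available. *)
Definition fresh ch (x : R) : bool := `[< ~ box ch x /\ ~ box ch (x *+ 2) >].

Lemma chain_extend N ch x : chain N ch -> (0 < N)%N -> fresh ch x ->
  exists2 t, (t <= N)%N & chain N ((x, t) :: ch).
Proof.
move=> ch_ok N_gt0 /asboolP [nx1 nx2].
have [ex|nex] := pselect (exists u, (0 < u <= 2 * N)%N && `[< box ch (x *+ u) >]).
  have := ex_minnP ex; case=> u /andP [/andP [u_gt0 uN]] /asboolP bu umin.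
  have u1 : u <> 1%N by move=> u1; apply: nx1; rewrite u1 mulr1n in bu.
  have u2 : u <> 2%N by move=> u2; apply: nx2; rewrite u2 in bu.
  (* The largest [t] with [2 * t < u]; then [u <= 2 * t + 2]. *)
  exists (u.-1./2); first by lia.
  split=> //=; first by lia.
    move=> w wu bw; suff : (u <= w)%N by lia.
    by apply: umin; apply/andP; split; [lia | apply/asboolP].
  by right; exists u => //; lia.
exists N => //; split=> //=; last by left.
move=> u uN bu; apply: nex; exists u; rewrite uN; exact/asboolP.
Qed.

(** While [N] fresh indices remain, [cnt_block] replaces them by [N] copies of one of them, of which
    [t] enter the chain. The probability stays at least [1 / q], and each round trades [N] indices
    for one chain element. *)
Lemma greedy_chain l q ch rest : let N := (2 ^ l)%N in
  chain N ch -> (forall p, p \in ch -> exists i, p.1 = v i) -> uniq rest ->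
  (4 ^ (size (flat ch) + size rest) <= cnt (flat ch ++ map v rest) 0 * q)%N ->
  exists ch' rest',
    [/\ chain N ch', (forall p, p \in ch' -> exists i, p.1 = v i),
        (4 ^ size (flat ch') <= cnt (flat ch') 0 * q)%N,
        uniq rest' /\ {subset rest' <= rest}
      & (size rest + N * size ch <= size rest' + N * size ch')%N /\
        (size [seq i <- rest' | fresh ch' (v i)] < N)%N].
Proof.
move=> N; have [m] := ubnP (size rest); elim: m => // m IH in ch rest *.
move=> szm ch_ok ch_v uniq_rest le1; have N_gt0 : (0 < N)%N by rewrite expn_gt0.
have [fewN|manyN] := ltnP (size [seq i <- rest | fresh ch (v i)]) N.
  exists ch, rest; split=> //; last by split.
  rewrite -(@leq_pmul2l (4 ^ size rest)) ?expn_gt0 // -expnD addnC.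
  apply: (leq_trans le1).
  rewrite mulnA leq_mul2r (cnt_perm _ (permEl (perm_catC _ _))).
  by rewrite -(size_map v) cnt_cat0 orbT.
pose J := take N [seq i <- rest | fresh ch (v i)].
pose rest1 := drop N [seq i <- rest | fresh ch (v i)] ++
              [seq i <- rest | predC (fun i => fresh ch (v i)) i].
have perm1 : perm_eq (J ++ rest1) rest.
  by rewrite /J /rest1 catA cat_take_drop perm_filterC.
have szJ : size J = N by rewrite size_takel.
have szrest : size rest = (N + size rest1)%N.
  by rewrite -(perm_size perm1) size_cat szJ.
have uniq1 : uniq rest1.
  by move: uniq_rest; rewrite -(perm_uniq perm1) cat_uniq => /and3P [].
have sub1 : {subset rest1 <= rest}.
  by move=> i i1; rewrite -(perm_mem perm1) mem_cat i1 orbT.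
have szvJ : size (map v J) = N by rewrite size_map.
have [x /mapP [i iJ xE] le2] := @cnt_block _ l (map v J) (flat ch ++ map v rest1) szvJ.
have fx : fresh ch x.
  by rewrite xE; move/mem_take: iJ; rewrite mem_filter => /andP [].
have [t tN chx_ok] := chain_extend ch_ok N_gt0 fx.
have [|||||ch' [rest' [h1 h2 h3 [h4 h5] [h6 h7]]]] := IH ((x, t) :: ch) rest1.
- by rewrite szrest in szm; lia.
- exact: chx_ok.
- by move=> p; rewrite inE => /orP [/eqP ->|/ch_v //]; exists i.
- exact: uniq1.
- rewrite /flat /= -/(flat ch) size_cat size_nseq.
  (* The [N - t] surplus copies are dropped; each accounts for at most a factor 4 of the count. *)
  rewrite -(@leq_pmul2l (4 ^ (N - t))) ?expn_gt0 // -expnD.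
  rewrite (_ : N - t + _ = size (flat ch) + size rest)%N; last by rewrite szrest; lia.
  apply: (leq_trans le1); rewrite mulnA leq_mul2r; apply/orP; right.
  have <- : cnt (map v J ++ flat ch ++ map v rest1) 0 = cnt (flat ch ++ map v rest) 0.
    apply: cnt_perm; rewrite perm_catCA perm_cat2l -map_cat.
    exact: perm_map.
  have NE : nseq (2 ^ l) x = nseq (N - t) x ++ nseq t x by rewrite -nseqD subnK.
  apply: (leq_trans le2); rewrite NE -!catA.
  by apply: (leq_trans (cnt_cat0 _ _)); rewrite size_nseq.
exists ch', rest'; split=> //; split=> //.
  by move=> j /h5 /sub1.
by rewrite szrest; move: h6 => /=; rewrite mulnS; lia.
Qed.

End Greedy.

(** * The linear inverse theorem *)

Definition commensurable (R : comPzRingType) (n k : nat) (L D : nat) (g : 'I_k -> 'I_n)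
    (v : 'I_n -> R) (j : 'I_n) : Prop :=
  exists2 m : 'I_k -> int, (forall h, (`|m h| <= L)%N) &
    v j *+ D = \sum_(h < k) v (g h) *~ m h.

Lemma inverse_littlewood_offord (R : comPzRingType) (n l c : nat) (v : 'I_n -> R) :
  let N := (2 ^ l)%N in (0 < n)%N -> (0 < l)%N ->
  (4 ^ n <= cnt (map v (enum 'I_n)) 0 * N ^ c)%N ->
  exists (g : {ffun 'I_(2 * c) -> 'I_n}) (D : nat),
    [/\ (0 < D <= N ^ (4 * c + 1))%N
      & (#|[set j | ~~ `[< commensurable (N ^ (4 * c + 3)) D g v j >]]| <=
         (2 * c * l + 1) * N)%N].
Proof.
move=> N n_gt0 l_gt0 le1.
have N_gt0 : (0 < N)%N by rewrite expn_gt0.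
have N_gt1 : (1 < N)%N by rewrite -[1%N](expn0 2) ltn_exp2l.
have [||||ch [rest [ch_ok ch_v le2 [uniq_rest _] [sz_rest few]]]] :=
  @greedy_chain R _ v l (N ^ c) [::] (enum 'I_n) => //.
- exact: enum_uniq.
- by rewrite /= add0n size_enum_ord.
have vol_N := vol_le ch_ok le2; rewrite -expnM in vol_N.
have sz_ch : (size ch <= 2 * c * l)%N.
  have := leq_trans (expn_size_le_vol ch_ok) vol_N.
  by rewrite -expnM leq_exp2l // (_ : l * (c * 2) = 2 * c * l)%N //; ring.
have sz_W : (size (big_part N ch) <= 2 * c)%N.
  by have := leq_trans (expn_big_part_le_vol N ch) vol_N; rewrite leq_exp2l // mulnC.
have [D /andP [D_gt0 leD] denom] := box_denominator N_gt0 ch_ok.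
have leV : (vol ch ^ 2 <= N ^ (4 * c))%N.
  have -> : (4 * c = c * 2 * 2)%N by lia.
  by rewrite [in leqRHS]expnM leq_exp2r.
have [J JE] : exists J, [seq p.1 | p <- big_part N ch] = map v J.
  have : forall p, p \in big_part N ch -> exists i, p.1 = v i.
    by move=> p; rewrite mem_filter => /andP [_ /ch_v].
  elim: (big_part N ch) => [|p W IH] W_v; first by exists [::].
  have [i pE] := W_v p (mem_head _ _).
  have [q qW|J JE] := IH; first by apply: W_v; rewrite inE qW orbT.
  by exists (i :: J); rewrite /= pE JE.
have szJ : (size J <= 2 * c)%N.
  by rewrite -(size_map v) -JE size_map.
pose i0 := Ordinal n_gt0; pose g := [ffun h : 'I_(2 * c) => nth i0 J h].
have comm L E j : lin (fun=> L) (big_part N ch) (v j *+ E) -> commensurable L E g v j.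
  move=> /(lin_cat_ex i0 JE) [m mL vE].
  exists (fun h => if (h < size J)%N then m h else 0).
    by move=> h; case: ifP => // /mL [].
  rewrite vE (big_ord_widen _ (fun h => v (nth i0 J h) *~ m h) szJ) [LHS]big_mkcond /=.
  by apply: eq_bigr => h _; rewrite ffunE; case: ifP => // _; rewrite mulr0z.
have commW L L' E E' F j : (F * E = E')%N -> (F * L <= L')%N ->
   commensurable L E g v j -> commensurable L' E' g v j.
  move=> <- FL [m mL vE]; exists (fun h => m h * F%:Z).
    by move=> h; rewrite abszM mulnC (leq_trans _ FL) // leq_mul.
  by rewrite mulnC mulrnA vE -sumrMnl; apply: eq_bigr => h _; rewrite pmulrn -mulrzA.
(* An index that is not fresh may have only [2 v_j] in the box, so the denominator is doubled to
   serve both cases. *)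
exists g, (2 * D)%N; split.
  rewrite muln_gt0 D_gt0 /= addn1 expnS leq_mul //.
  exact: leq_trans leV.
have good j : j \in rest -> ~~ fresh ch (v j) ->
    commensurable (N ^ (4 * c + 3)) (2 * D) g v j.
  move=> _ /asboolPn nfresh.
  pose L := (2 * N * vol ch ^ 2)%N.
  have le4 : (2 * L <= N ^ (4 * c + 3))%N.
    rewrite /L expnD mulnA [leqRHS]mulnC leq_mul // !expnS expn0; nia.
  have [b1|nb1] := pselect (box ch (v j)).
    by apply: (@commW L _ D _ 2) => //; apply: comm; apply: denom.
  have [b2|nb2] := pselect (box ch (v j *+ 2)).
    apply: (@commW L _ (2 * D) _ 1); rewrite ?mul1n //; try lia.
    by apply: comm; rewrite mulrnA; apply: denom.
  by case: nfresh.
(* An exceptional index was consumed, at most [N] per chain element, or is one of the fewer than [N]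
   fresh indices left. *)
apply: (@leq_trans #|[predU [predC rest] & [seq i <- rest | fresh ch (v i)]]|).
  apply/subset_leq_card/subsetP => j; rewrite !inE => nj.
  apply/orP; case: (boolP (j \in rest)) => jr; last by left.
  right; rewrite mem_filter jr andbT; apply/negPn/negP => nf.
  by move/negP: nj; apply; apply/asboolP; apply: good.
rewrite -(leq_add2r #|[predI [predC rest] & [seq i <- rest | fresh ch (v i)]]|) cardUI.
apply: leq_trans (leq_addr _ _).
have -> : #|[predC rest]| = (n - size rest)%N.
  by have := cardC (mem rest); rewrite (card_uniqP uniq_rest) card_ord => E; rewrite -[X in (X - _)%N]E addKn.
rewrite (card_uniqP (filter_uniq _ uniq_rest)) mulnDl mul1n leq_add //; last exact: ltnW.
rewrite leq_subLR; rewrite size_enum_ord muln0 addn0 in sz_rest.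
by apply: (leq_trans sz_rest); rewrite leq_add2l mulnC leq_mul.
Qed.

(** * Counting *)

Definition ffcons (T : finType) n (t : T) (g : {ffun 'I_n -> T}) : {ffun 'I_n.+1 -> T} :=
  [ffun i => oapp g t (unlift ord0 i)].

Lemma big_ffunS (T : finType) n (G : {ffun 'I_n.+1 -> T} -> nat) :
  (\sum_f G f = \sum_(t : T) \sum_(g : {ffun 'I_n -> T}) G (ffcons t g))%N.
Proof.
rewrite pair_big /= (reindex (fun p : T * {ffun 'I_n -> T} => ffcons p.1 p.2)) //=.
exists (fun f : {ffun 'I_n.+1 -> T} => (f ord0, [ffun i => f (lift ord0 i)])).
  move=> [t g] _ /=; rewrite ffunE unlift_none /=; congr (_, _).
  by apply/ffunP => i; rewrite !ffunE liftK.
move=> f _; apply/ffunP => i; rewrite !ffunE /=.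
by case: unliftP => [j ->|->] /=; rewrite ?ffunE.
Qed.

Definition collisions (R : nmodType) n (v : 'I_n -> R) : nat :=
  #|[set p : {ffun 'I_n -> bool} * {ffun 'I_n -> bool} |
      \sum_i v i *+ p.1 i == \sum_i v i *+ p.2 i]|.

Lemma big_subset_sums_ffun (R : comPzRingType) n (v : 'I_n -> R) (F : R -> nat) :
  (\sum_(f : {ffun 'I_n -> bool}) F (\sum_i v i *+ f i)%R =
   \sum_(a <- subset_sums (map v (enum 'I_n))) F a)%N.
Proof.
elim: n v F => [|n IH] v F.
  rewrite enum_ord0 /= big_seq1; under eq_bigr do rewrite big_ord0.
  by rewrite sum_nat_const card_ffun card_ord expn0 mul1n.
rewrite big_ffunS enum_ordSl map_cons -map_comp big_subset_sums_cons big_bool [RHS]addnC /=.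
rewrite -!IH; congr (_ + _)%N; apply: eq_bigr => f _; rewrite big_ord_recl ffunE unlift_none /=.
  rewrite mulr1n; congr (F (_ + _)); apply: eq_bigr => i _.
  by rewrite ffunE liftK.
rewrite mulr0n add0r; congr F; apply: eq_bigr => i _.
by rewrite ffunE liftK.
Qed.

Lemma card_set_sum (T : finType) (P : pred T) : #|[set x | P x]| = (\sum_x P x)%N.
Proof. by rewrite -sum1dep_card big_mkcond. Qed.

Lemma collisions_cnt (R : comPzRingType) n (v : 'I_n -> R) :
  collisions v = cnt (map v (enum 'I_n)) 0.
Proof.
rewrite /collisions card_set_sum.
pose F (p : {ffun 'I_n -> bool} * {ffun 'I_n -> bool}) : nat :=
  \sum_i v i *+ p.1 i == \sum_i v i *+ p.2 i.
rewrite (eq_bigr (fun p => F (p.1, p.2))); last by case.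
rewrite -(pair_big xpredT xpredT (fun a b => F (a, b))) /=.
rewrite /cnt -big_subset_sums_ffun; apply: eq_bigr => f _.
rewrite /F /= (big_subset_sums_ffun v (fun b => (\sum_i v i *+ f i == b)%R : nat)).
by apply: eq_bigr => b _; rewrite addr0.
Qed.

Lemma card_bffun n : #|{ffun 'I_n -> bool}| = (2 ^ n)%N.
Proof. by rewrite card_ffun card_bool card_ord. Qed.

Lemma collisions_le (R : nmodType) n (v : 'I_n -> R) : (collisions v <= 4 ^ n)%N.
Proof.
apply: (leq_trans (max_card _)).
by rewrite card_prod card_bffun -expnMn.
Qed.

(** A reverse Markov inequality: the unpopular points contribute at most half of the total, since
    [N >= 2]. *)
Lemma card_popular (X : finType) (f : X -> nat) (M N c : nat) : (1 < N)%N -> (0 < M)%N ->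
  (forall x, f x <= M)%N -> (#|X| * M <= (\sum_x f x) * N ^ c)%N ->
  (#|X| <= #|[set x | (M <= f x * N ^ c.+1)%N]| * N ^ c.+1)%N.
Proof.
move=> N_gt1 M_gt0 fM le1; set A := [set x | _].
have [->//|X_gt0] := posnP #|X|.
have le2 : ((\sum_x f x) * N ^ c.+1 <= #|A| * (M * N ^ c.+1) + #|X| * M)%N.
  rewrite big_distrl /= (bigID (mem A)) /=; apply: leq_add.
    by rewrite -sum_nat_const; apply: leq_sum => x _; rewrite leq_mul2r fM orbT.
  rewrite -sum_nat_const big_mkcond /=; apply: leq_sum => x _.
  by case: ifP => //; rewrite inE -ltnNge => /ltnW.
have le3 : (2 * (#|X| * M) <= (\sum_x f x) * N ^ c.+1)%N.
  by rewrite expnS [leqRHS]mulnCA leq_mul.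
rewrite -(@leq_pmul2r M) // -mulnA [(N ^ _ * M)%N]mulnC.
have := leq_trans le3 le2.
by rewrite mulSn mul1n leq_add2r.
Qed.

Lemma pigeonhole (X Y : finType) (A : {set X}) (P : X -> Y -> Prop) :
  (0 < #|A|)%N -> (forall x, x \in A -> exists y, P x y) ->
  exists y, (#|A| <= #|[set x in A | `[< P x y >]]| * #|Y|)%N.
Proof.
move=> A_gt0 AP; apply: contrapT => /forallNP noy.
have Y_gt0 : (0 < #|Y|)%N.
  by have [x /AP [y _]] := card_gt0P A_gt0; apply/card_gt0P; exists y.
have cover : (#|A| <= \sum_y #|[set x in A | `[< P x y >]]|)%N.
  rewrite -sum1_card; under [leqRHS]eq_bigr do rewrite -sum1dep_card big_mkcondr /=.
  rewrite exchange_big /=; apply: leq_sum => x /AP [y Pxy].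
  by rewrite (bigD1 y) //=; case: asboolP.
suff : (#|A| * #|Y| < #|A| * #|Y|)%N by rewrite ltnn.
apply: (@leq_ltn_trans ((\sum_y #|[set x in A | `[< P x y >]]|) * #|Y|)%N).
  by rewrite leq_mul2r cover orbT.
rewrite big_distrl /= [ltnRHS]mulnC -sum_nat_const.
have lt y : (#|[set x in A | `[< P x y >]]| * #|Y| < #|A|)%N.
  by rewrite ltnNge; apply/negP; exact: noy.
have [y0 _] := card_gt0P Y_gt0.
rewrite (bigD1 y0) //= [ltnRHS](bigD1 y0) //=.
by rewrite -addSn leq_add // leq_sum // => y _; apply: ltnW.
Qed.

(** An exponential moment. Give [U] a factor 2 for each index of [S] with [U j != s]: the average
    weight is [(3 / 2) ^ b], but each counted [U] has weight at least [2 ^ (b - m)]. *)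
Lemma card_mostly_avoiding n (S : {set 'I_n}) (s : bool) (m r : nat) :
  (2 ^ n <= #|[set U : {ffun 'I_n -> bool} | (#|[set j in S | U j == s]| <= m)%N]| * 2 ^ r)%N ->
  (#|S| <= 3 * (m + r) + 2)%N.
Proof.
set A := [set U | _] => le1; set b := #|S|.
pose w (j : 'I_n) (x : bool) : nat := if (j \in S) && (x != s) then 2 else 1.
have sumw : (\sum_(U : {ffun 'I_n -> bool}) \prod_j w j (U j) = 3 ^ b * 2 ^ (n - b))%N.
  rewrite -(bigA_distr_bigA w) (bigID (mem S)) /=; congr (_ * _)%N.
    rewrite -prod_nat_const; apply: eq_bigr => j jS.
    by rewrite big_bool /w jS /=; case: (s).
  have -> : (n - b = #|~: S|)%N by rewrite [in RHS]cardsCs setCK card_ord.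
  rewrite -prod_nat_const; apply: eq_big => [j|j /negbTE jS]; first by rewrite inE.
  by rewrite big_bool /w jS.
have prodw U : (\prod_j w j (U j) * 2 ^ #|[set j in S | U j == s]| = 2 ^ b)%N.
  have -> : (\prod_j w j (U j) = 2 ^ #|[set j in S | U j != s]|)%N.
    rewrite -prod_nat_const [RHS]big_mkcond; apply: eq_bigr => j _.
    by rewrite inE.
  rewrite -expnD; congr (_ ^ _)%N.
  rewrite /b -(cardsID [set j | U j != s] S) setIdE; congr (_ + _)%N.
  by apply: eq_card => j; rewrite !inE negbK andbC.
have le2 : (#|A| * 2 ^ b <= 2 ^ m * (3 ^ b * 2 ^ (n - b)))%N.
  rewrite -sumw big_distrr -sum_nat_const big_mkcond; apply: leq_sum => U _ /=.
  rewrite /A inE; case: ifP => // le; rewrite -(prodw U) mulnC leq_mul2r.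
  by rewrite leq_exp2l // le orbT.
have le3 : (4 ^ b <= 2 ^ (m + r) * 3 ^ b)%N.
  have bn : (b <= n)%N by rewrite -[n in leqRHS]card_ord max_card.
  rewrite -(@leq_pmul2r (2 ^ (n - b))) ?expn_gt0 //.
  rewrite (_ : 4 = 2 * 2)%N // expnMn -mulnA -[(_ * 2 ^ (n - b))%N]expnD subnKC //.
  apply: (leq_trans (leq_mul (leqnn _) le1)).
  rewrite mulnCA mulnA [leqLHS]mulnC expnD -!mulnA [leqRHS]mulnCA.
  by rewrite leq_mul2l le2 orbT.
(* Every three indices gain a factor 2, because [2 * 3 ^ 3 <= 4 ^ 3]. *)
have le4 : (2 ^ (b %/ 3) * 3 ^ b <= 4 ^ b)%N.
  have leq_expn k : (3 ^ k <= 4 ^ k)%N by case: k => // k; rewrite leq_exp2r.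
  rewrite {2 3}(divn_eq b 3) !expnD mulnA leq_mul //.
  rewrite [(_ * 3)%N]mulnC !expnM -expnMn.
  by case: (b %/ 3)%N => // k; rewrite leq_exp2r.
have := leq_trans le4 le3; rewrite leq_pmul2r ?expn_gt0 // leq_exp2l // => le5.
by rewrite {1}(divn_eq b 3) mulnC leq_add ?leq_mul // -ltnS ltn_pmod.
Qed.

(** * Random restrictions *)

Notation bvec n := {ffun 'I_n -> bool}.

Definition mask (R : nmodType) n (U : 'I_n -> bool) (v : 'I_n -> R) (i : 'I_n) : R :=
  if U i then v i else 0.

Definition incommensurable (R : comPzRingType) n k L D (g : 'I_k -> 'I_n) (v : 'I_n -> R) :=
  [set j | ~~ `[< commensurable L D g v j >]].

Lemma commensurable_mask (R : comPzRingType) n k L D (g : 'I_k -> 'I_n) (v : 'I_n -> R)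
    (U : 'I_n -> bool) j : U j ->
  commensurable L D g (mask U v) j -> commensurable L D g v j.
Proof.
move=> Uj [m mL]; rewrite /mask Uj => vE.
exists (fun h => if U (g h) then m h else 0); first by move=> h; case: ifP.
by rewrite vE; apply: eq_bigr => h _; case: ifP; rewrite ?mul0rz ?mulr0z.
Qed.

Lemma card_generator_data n k l e d : (n <= 2 ^ (l * e))%N -> (0 < l)%N ->
  (#|{: {ffun 'I_k -> 'I_n} * 'I_((2 ^ l) ^ d).+1}| <= 2 ^ (l * (e * k + d.+1)))%N.
Proof.
move=> nN l_gt0; rewrite card_prod card_ffun !card_ord mulnDr expnD mulnA [in leqRHS]expnM.
apply: leq_mul; first by case: k => // k; rewrite leq_exp2r.
rewrite -expnM mulnS expnD (leq_trans (_ : _ <= 2 * 2 ^ (l * d)))%N //.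
  by rewrite mul2n -addnn -addn1 leq_add2l expn_gt0.
by rewrite leq_mul2r (@leq_exp2l 2 1) // l_gt0 orbT.
Qed.

Definition masked_collisions (R : nmodType) n (w : 'I_n -> R) : nat :=
  #|[set x : bvec n * (bvec n * bvec n) |
      \sum_i mask x.1 w i *+ x.2.1 i == \sum_i mask x.1 w i *+ x.2.2 i]|.

Lemma masked_collisionsE (R : nmodType) n (w : 'I_n -> R) :
  masked_collisions w = (\sum_(U : bvec n) collisions (mask U w))%N.
Proof.
rewrite /masked_collisions card_set_sum.
under [RHS]eq_bigr do rewrite /collisions card_set_sum.
by rewrite pair_big.
Qed.

(* Exceptional set bounds: [loss l c] for a single vector, [masked_loss l e c]
   once the masks are removed. *)
Definition loss l c := ((2 * c * l + 1) * 2 ^ l)%N.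
Definition masked_loss l e c :=
  (3 * (loss l c + l * (c + (e * (2 * c) + (4 * c + 2)))) + 2)%N.

(** The linear theorem applies to [mask U w] for many [U], and pigeonhole fixes [g] and [D]. An
    index of [U] that is bad for [w] is bad for the masked vector, so many [U] contain few bad
    indices, which forces the bad set to be small. *)
Lemma masked_littlewood_offord (R : comPzRingType) n l e c (w : 'I_n -> R) :
  let N := (2 ^ l)%N in let c' := c.+1 in
  (0 < n)%N -> (0 < l)%N -> (n <= 2 ^ (l * e))%N ->
  (8 ^ n <= masked_collisions w * N ^ c)%N ->
  exists (g : {ffun 'I_(2 * c') -> 'I_n}) (D : nat),
    (0 < D <= N ^ (4 * c' + 1))%N /\
    (#|incommensurable (N ^ (4 * c' + 3)) D g w| <= masked_loss l e c')%N.
Proof.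
move=> N c' n_gt0 l_gt0 nN; rewrite masked_collisionsE => le1.
have N_gt1 : (1 < N)%N by rewrite -[1%N](expn0 2) ltn_exp2l.
pose A := [set U : bvec n | (4 ^ n <= collisions (mask U w) * N ^ c')%N].
have A_big : (2 ^ n <= #|A| * N ^ c')%N.
  rewrite -card_bffun; apply: card_popular => //; first by rewrite expn_gt0.
    by move=> U; apply: collisions_le.
  by rewrite card_bffun -expnMn.
have A_gt0 : (0 < #|A|)%N.
  by rewrite lt0n; apply: contraTneq A_big => ->; rewrite mul0n -ltnNge expn_gt0.
pose P (U : bvec n) (y : {ffun 'I_(2 * c') -> 'I_n} * 'I_(N ^ (4 * c' + 1)).+1) :=
  (0 < y.2)%N /\ (#|incommensurable (N ^ (4 * c' + 3)) y.2 y.1 (mask U w)| <= loss l c')%N.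
have AP U : U \in A -> exists y, P U y.
  rewrite inE collisions_cnt => /(inverse_littlewood_offord n_gt0 l_gt0).
  case=> g [D [/andP [D_gt0 leD] bad]].
  by exists (g, Ordinal (leD : (D < _.+1)%N)); split.
have [[g D] le2] := pigeonhole A_gt0 AP.
have D_gt0 : (0 < D)%N.
  case: (posnP D) => // D0; rewrite (_ : [set U in A | _] = set0) ?cards0 ?mul0n in le2.
    by rewrite leqNgt A_gt0 in le2.
  by apply/setP => U; rewrite !inE; apply/negP => /andP [_ /asboolP []] /=; rewrite D0.
exists g, D; split; first by rewrite D_gt0 -ltnS ltn_ord.
apply: (@card_mostly_avoiding _ _ true).
set A' := [set U | _].
have le3 : (#|A| <= #|A'| * 2 ^ (l * (e * (2 * c') + (4 * c' + 2))))%N.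
  apply: (leq_trans le2); apply: leq_mul; last first.
    by have := card_generator_data (2 * c') (4 * c' + 1) nN l_gt0; rewrite addn1 addn2.
  apply/subset_leq_card/subsetP => U; rewrite !inE => /andP [_ /asboolP [/= _ bad]].
  apply: leq_trans bad; apply/subset_leq_card/subsetP => j; rewrite !inE.
  move=> /andP [nj /eqP Uj]; apply: contra nj => /asboolP cj; apply/asboolP.
  exact: commensurable_mask cj.
apply: (leq_trans A_big); rewrite mulnDr expnD mulnA [leqRHS]mulnAC -expnM.
by rewrite leq_mul2r le3 orbT.
Qed.

(** * Column relations from bilinear concentration *)

Section Bilinear.
Variables (R : comPzRingType) (n l e c : nat) (A : 'I_n -> 'I_n -> R).
Let N := (2 ^ l)%N.
Hypotheses (n_gt0 : (0 < n)%N) (l_gt0 : (0 < l)%N) (nN : (n <= 2 ^ (l * e))%N).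

(** The triple [x] stands for [(U, (a, a'))], and these are the partial column sums over [U]. *)
Definition row_form (x : bvec n * (bvec n * bvec n)) (j : 'I_n) : R :=
  \sum_i mask x.1 (A^~ j) i *+ x.2.1 i - \sum_i mask x.1 (A^~ j) i *+ x.2.2 i.

Definition cut_form (x : bvec n * (bvec n * bvec n)) : 'I_n -> R :=
  mask (fun j => ~~ x.1 j) (row_form x).

Let c1 := c.+1.
Let k := (2 * c1)%N.
Let L := (N ^ (4 * c1 + 3))%N.
Let Dmax := (N ^ (4 * c1 + 1))%N.
(** Accumulated losses, as exponents of [N]: [r2] for passing to popular triples and fixing
    [(g, D)]; [r3] includes also a factor [2 * n] and the at most [N ^ (4 * c1 + 5)] choices for
    each of [k] coefficients. *)
Let r2 := (c1 + (e * k + (4 * c1 + 2)))%N.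
Let r3 := (e + r2 + (k * (4 * c1 + 5)) + 1)%N.

(** The columns whose relation holds for few triples form [B]. At least half of the triples in [G']
    have no valid relation at a column of [B] outside [U], so such [U] nearly cover [B]. For any
    other column, pigeonhole fixes the coefficients. *)
Lemma rows_commensurable :
  (8 ^ n * 4 ^ n <= (\sum_x collisions (cut_form x)) * N ^ c)%N ->
  exists (g : {ffun 'I_k -> 'I_n}) (D : nat) (B : {set 'I_n}),
  [/\ (0 < D <= Dmax)%N, (#|B| <= 3 * (loss l c1 + (l * r2 + 1)) + 2)%N &
   forall j, j \notin B -> exists q : 'I_k -> int,
     (forall h, (`|q h| <= L)%N) /\
     (8 ^ n <= masked_collisions
         (fun i => A i j *+ D - \sum_(h < k) A i (g h) *~ q h)%R * N ^ r3)%N].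
Proof.
move=> le1.
have N_gt1 : (1 < N)%N by rewrite -[1%N](expn0 2) ltn_exp2l.
have cardX : #|{: bvec n * (bvec n * bvec n)}| = (8 ^ n)%N.
  by rewrite !card_prod !card_bffun -!expnMn.
pose G := [set x : bvec n * (bvec n * bvec n) |
             (4 ^ n <= collisions (cut_form x) * N ^ c1)%N].
have G_big : (8 ^ n <= #|G| * N ^ c1)%N.
  rewrite -cardX; apply: card_popular => //; first by rewrite expn_gt0.
    by move=> x; apply: collisions_le.
  by rewrite cardX.
have G_gt0 : (0 < #|G|)%N.
  by rewrite lt0n; apply: contraTneq G_big => ->; rewrite mul0n -ltnNge expn_gt0.
pose P (x : bvec n * (bvec n * bvec n)) (y : {ffun 'I_k -> 'I_n} * 'I_Dmax.+1) :=
  (0 < y.2)%N /\ (#|incommensurable L y.2 y.1 (cut_form x)| <= loss l c1)%N.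
have GP x : x \in G -> exists y, P x y.
  rewrite inE collisions_cnt => /(inverse_littlewood_offord n_gt0 l_gt0).
  case=> g [D [/andP [D_gt0 leD] bad]].
  by exists (g, Ordinal (leD : (D < _.+1)%N)); split.
have [[g D] le2] := pigeonhole G_gt0 GP.
set G' := [set x in G | _] in le2.
have G'_gt0 : (0 < #|G'|)%N.
  by rewrite lt0n; apply: contraTneq le2 => ->; rewrite mul0n -ltnNge.
have D_gt0 : (0 < D)%N.
  by have [x] := card_gt0P G'_gt0; rewrite inE => /andP [_ /asboolP []].
have G'_big : (8 ^ n <= #|G'| * 2 ^ (l * r2))%N.
  apply: (leq_trans G_big); rewrite /r2 mulnDr expnD -expnM mulnCA [leqLHS]mulnC.
  rewrite leq_mul2l; apply/orP; right; apply: (leq_trans le2); rewrite leq_mul2l.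
  have := card_generator_data k (4 * c1 + 1) nN l_gt0; rewrite -addnS => le3.
  by apply/orP; right; exact: le3.
have G'_bad x : x \in G' -> (#|incommensurable L D g (cut_form x)| <= loss l c1)%N.
  by rewrite inE => /andP [_ /asboolP []].
pose H j := [set x in G' | ~~ x.1 j && `[< commensurable L D g (cut_form x) j >]].
(* With the threshold [1 / (2 n)], a union over at most [n] columns loses at most half of [G']. *)
pose B := [set j | (#|H j| * (2 * n) < #|G'|)%N].
exists g, D, B; split; first by rewrite D_gt0 -ltnS ltn_ord.
  pose G'' := [set x in G' | [forall j in B, x \notin H j]].
  have G''_big : (#|G'| <= #|G''| * 2)%N.
    have le3 : (2 * n * #|G' :\: G''| <= n * #|G'|)%N.
      have le4 : (#|G' :\: G''| <= \sum_(j in B) #|H j|)%N.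
        rewrite -sum1_card.
        have -> : (\sum_(j in B) #|H j| = \sum_x \sum_(j in B) (x \in H j))%N.
          rewrite exchange_big; apply: eq_bigr => j _.
          by rewrite -sum1_card big_mkcond.
        rewrite big_mkcond; apply: leq_sum => x _; case: ifP => //.
        rewrite inE andbC => /andP [xG']; rewrite inE xG' => /forall_inPn [j jB].
        by rewrite negbK => xH; rewrite (bigD1 j) //= xH.
      apply: (leq_trans (leq_mul (leqnn _) le4)); rewrite big_distrr /=.
      apply: (@leq_trans (\sum_(j in B) #|G'|)%N).
        by apply: leq_sum => j; rewrite inE mulnC => /ltnW.
      by rewrite sum_nat_const leq_mul2r -[n in (_ <= n)%N]card_ord max_card orbT.
    have : (2 * #|G' :\: G''| <= #|G'|)%N by rewrite -(leq_pmul2l n_gt0) mulnCA mulnA.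
    have := cardsID G'' G'; rewrite (setIidPr _); last by apply/subsetP => x; rewrite inE => /andP [].
    by lia.
  (* For [x] in [G''], every index of [B] outside [U] is exceptional for [cut_form x]. *)
  apply: (@card_mostly_avoiding _ _ false).
  set U0 := [set U | _].
  have le5 : (#|G''| <= #|U0| * 4 ^ n)%N.
    have -> : (4 ^ n = #|[set: bvec n * bvec n]|)%N.
      by rewrite cardsT card_prod !card_bffun -expnMn.
    rewrite -cardsX; apply/subset_leq_card/subsetP => x; rewrite inE => /andP [xG' /forall_inP xH].
    rewrite !inE andbT; apply: leq_trans (G'_bad _ xG').
    apply/subset_leq_card/subsetP => j; rewrite inE => /andP [jB /eqP xj].
    by have := xH j jB; rewrite inE xG' xj /= => nc; rewrite in_set.
  rewrite -(@leq_pmul2r (4 ^ n)) ?expn_gt0 // -expnMn.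
  apply: (leq_trans G'_big); rewrite expnD expn1 [leqRHS]mulnAC.
  rewrite [(2 ^ _ * 2)%N]mulnC mulnA leq_mul2r; apply/orP; right.
  by apply: (leq_trans G''_big); rewrite leq_mul2r le5.
move=> j; rewrite inE -leqNgt => H_big.
have H_gt0 : (0 < #|H j|)%N.
  by rewrite lt0n; apply: contraTneq H_big => ->; rewrite mul0n -ltnNge.
pose Q (x : bvec n * (bvec n * bvec n)) (q : {ffun 'I_k -> 'I_(2 * L).+1}) :=
  row_form x j *+ D = \sum_(h < k) row_form x (g h) *~ ((q h : nat)%:Z - L%:Z).
have HQ x : x \in H j -> exists q, Q x q.
  rewrite inE => /andP [_ /andP [xj /asboolP]].
  move=> /(commensurable_mask (U := fun j => ~~ x.1 j) xj) [m mL E].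
  have mlt h : (`|(m h + L%:Z)%R| < (2 * L).+1)%N by have := mL h; lia.
  exists [ffun h => Ordinal (mlt h)]; rewrite /Q E; apply: eq_bigr => h _.
  by rewrite ffunE /=; congr (_ *~ _); have := mL h; lia.
have [q le6] := pigeonhole H_gt0 HQ.
exists (fun h => (q h : nat)%:Z - L%:Z); split.
  by move=> h; have := ltn_ord (q h); lia.
set w := fun i => _.
have le7 : (#|[set x in H j | `[< Q x q >]]| <= masked_collisions w)%N.
  apply/subset_leq_card/subsetP => x; rewrite !inE => /andP [_ /asboolP QE].
  rewrite -subr_eq0.
  (* By linearity in the columns, the relation between values of [row_form] is a collision for the
     masked [w]. *)
  have lin_w (b : bvec n) : \sum_i mask x.1 w i *+ b i =
     (\sum_i mask x.1 (A^~ j) i *+ b i) *+ D -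
     \sum_(h < k) (\sum_i mask x.1 (A^~ (g h)) i *+ b i) *~ ((q h : nat)%:Z - L%:Z).
    have -> : \sum_(h < k) (\sum_i mask x.1 (A^~ (g h)) i *+ b i) *~ ((q h : nat)%:Z - L%:Z) =
       \sum_i \sum_(h < k) (mask x.1 (A^~ (g h)) i *+ b i) *~ ((q h : nat)%:Z - L%:Z).
      rewrite exchange_big /=; apply: eq_bigr => h _.
      by rewrite mulrz_suml.
    rewrite -sumrMnl -sumrB; apply: eq_bigr => i _.
    rewrite /mask /w; case: ifP => _; last first.
      by rewrite !mul0rn big1 ?subr0 // => h _; rewrite mul0rz.
    case: (b i); rewrite ?mulr1n ?mulr0n.
      by congr (_ - _); apply: eq_bigr => h _; rewrite mulr1n.
    by rewrite mul0rn big1 ?subr0 // => h _; rewrite mulr0n mul0rz.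
  rewrite !lin_w.
  have E : row_form x j *+ D = (\sum_i mask x.1 (A^~ j) i *+ x.2.1 i) *+ D -
     (\sum_i mask x.1 (A^~ j) i *+ x.2.2 i) *+ D by rewrite -mulrnBl.
  have F : \sum_(h < k) row_form x (g h) *~ ((q h : nat)%:Z - L%:Z) =
     \sum_(h < k) (\sum_i mask x.1 (A^~ (g h)) i *+ x.2.1 i) *~ ((q h : nat)%:Z - L%:Z) -
     \sum_(h < k) (\sum_i mask x.1 (A^~ (g h)) i *+ x.2.2 i) *~ ((q h : nat)%:Z - L%:Z).
    by rewrite -sumrB; apply: eq_bigr => h _; rewrite -mulrzBl.
  have aux (a b s t : R) : a - b = s - t -> a - s - (b - t) = 0.
    by move=> ab; rewrite -[RHS](subrr (a - b)) {2}ab; ring.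
  by move: QE; rewrite /Q E F => /aux /eqP.
have cardQ : (#|{: {ffun 'I_k -> 'I_(2 * L).+1}}| <= 2 ^ (l * (k * (4 * c1 + 5))))%N.
  have -> : (l * (k * (4 * c1 + 5)) = (4 * c1 + 5) * l * k)%N.
    by rewrite mulnCA mulnC (mulnC l).
  rewrite card_ffun !card_ord expnM.
  have leL : ((2 * L).+1 <= 2 ^ ((4 * c1 + 5) * l))%N.
    have -> : L = (2 ^ (l * (4 * c1 + 3)))%N by rewrite expnM.
    have -> : ((4 * c1 + 5) * l = l * (4 * c1 + 3) + 2 * l)%N.
      by rewrite (mulnC 2) -mulnDr mulnC -addnA.
    rewrite expnD.
    move: (2 ^ (l * (4 * c1 + 3)))%N (expn_gt0 2 (l * (4 * c1 + 3))) => M M_gt0.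
    apply: (@leq_trans (M * 4)%N); first by move: M_gt0; clear; lia.
    by rewrite leq_mul2l (_ : 4 = 2 ^ 2)%N // leq_exp2l ?leq_pmulr ?orbT.
  by case: (k) => // k'; rewrite leq_exp2r.
apply: (leq_trans G'_big); rewrite -[in leqRHS]expnM /r3.
apply: (@leq_trans (#|H j| * (2 ^ (l * (e + 1))) * 2 ^ (l * r2))%N).
  rewrite leq_mul2r; apply/orP; right; apply: (leq_trans H_big).
  rewrite leq_mul2l; apply/orP; right; rewrite addn1 mulnS expnD leq_mul //.
apply: (@leq_trans (masked_collisions w * 2 ^ (l * (k * (4 * c1 + 5))) *
                    (2 ^ (l * (e + 1))) * 2 ^ (l * r2))%N).
  do 2 rewrite leq_mul2r; rewrite (leq_trans le6) ?orbT //.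
  exact: leq_mul.
rewrite -!mulnA -!expnD leq_mul2l leq_exp2l // -!mulnDr; apply/orP; right.
by rewrite leq_mul2l; apply/orP; right; lia.
Qed.

End Bilinear.

(** * Decoupling *)

Lemma Cauchy_Schwarz_nat (T : finType) (f : T -> nat) :
  ((\sum_x f x) ^ 2 <= #|T| * \sum_x f x ^ 2)%N.
Proof.
rewrite -(@leq_pmul2l 2) // -mulnn big_distrl /=.
apply: (@leq_trans (\sum_x \sum_y (f x ^ 2 + f y ^ 2))%N).
  rewrite big_distrr; apply: leq_sum => x _ /=; rewrite !big_distrr.
  by apply: leq_sum => y _; apply: nat_Cauchy.
under eq_bigr do rewrite big_split /= sum_nat_const.
by rewrite big_split /= sum_nat_const -big_distrr /= mul2n addnn.
Qed.

(** Cauchy-Schwarz twice, over [X] and then over pairs from [Y]: a dense bipartite graph has many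
    four-cycles, degenerate ones included. *)
Lemma card_four_cycles (X Y : finType) (S : X -> Y -> bool) :
  ((\sum_x \sum_y S x y) ^ 4 <=
   #|X| ^ 2 * #|Y| ^ 2 *
   \sum_(p : X * X) \sum_(q : Y * Y)
     [&& S p.1 q.1, S p.2 q.1, S p.1 q.2 & S p.2 q.2])%N.
Proof.
have le1 := Cauchy_Schwarz_nat (fun x => \sum_y S x y)%N.
pose d (q : Y * Y) := (\sum_x S x q.1 * S x q.2)%N.
have E : (\sum_x (\sum_y S x y) ^ 2 = \sum_q d q)%N.
  rewrite /d exchange_big; apply: eq_bigr => x _.
  by rewrite -mulnn big_distrlr /= pair_big.
have le2 := Cauchy_Schwarz_nat d.
rewrite E in le1; rewrite card_prod in le2.
rewrite (_ : 4 = 2 * 2)%N // expnM.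
apply: (@leq_trans ((#|X| * \sum_q d q) ^ 2)%N); first by rewrite leq_exp2r.
rewrite expnMn -mulnA leq_mul2l (leq_trans le2) ?orbT //.
rewrite (mulnn #|Y|) leq_mul2l; apply/orP; right.
rewrite [leqRHS]exchange_big; apply: leq_sum => q _.
rewrite /d -mulnn big_distrlr /= pair_big /=; apply: leq_sum => p _.
by case: (S p.1 q.1); case: (S p.1 q.2); case: (S p.2 q.1); case: (S p.2 q.2).
Qed.

Section Decoupling.
Variables (R : realDomainType) (n : nat) (A : 'I_n -> 'I_n -> R).
Hypothesis A_sym : forall i j, A i j = A j i.

Definition sgn (b : bool) : R := if b then 1 else -1.

Definition quad_form (a : bvec n) : R := \sum_i \sum_j A i j * sgn (a i) * sgn (a j).

Definition mix (U a b : bvec n) : bvec n := [ffun i => if U i then a i else b i].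

(** The mixed second difference keeps only terms crossing between [U] and its complement, with a
    factor 8: 4 from using [sgn b = 2 b - 1] twice, and 2 from the symmetry of [A]. *)
Lemma four_cycle_collision (U a a' b b' : bvec n) :
  quad_form (mix U a b) - quad_form (mix U a' b)
    - (quad_form (mix U a b') - quad_form (mix U a' b')) = 0 ->
  \sum_j cut_form A (U, (a, a')) j *+ b j = \sum_j cut_form A (U, (a, a')) j *+ b' j.
Proof.
have bool_mul (z : R) (d : bool) : z *+ d = z * d%:R by rewrite mulr_natr.
pose x i : R := if U i then (a i)%:R - (a' i)%:R else 0.
pose y i : R := if U i then 0 else (b i)%:R - (b' i)%:R.
pose Q := \sum_i \sum_j A i j * x i * y j.
have sgnE c : sgn c = 2 * c%:R - 1 by case: c; rewrite /sgn /=; ring.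
have -> : quad_form (mix U a b) - quad_form (mix U a' b)
    - (quad_form (mix U a b') - quad_form (mix U a' b')) = 8 * Q.
  have QT : Q = \sum_i \sum_j A i j * y i * x j.
    rewrite /Q exchange_big; apply: eq_bigr => i _; apply: eq_bigr => j _.
    by rewrite A_sym mulrAC.
  rewrite (_ : 8 * Q = 4 * Q + 4 * Q); last by ring.
  rewrite {2}QT /Q /quad_form !mulr_sumr -!sumrB -big_split; apply: eq_bigr => i _ /=.
  rewrite !mulr_sumr -!sumrB -big_split; apply: eq_bigr => j _ /=.
  rewrite !ffunE !sgnE /x /y.
  by case: (U i); case: (U j); ring.
move=> /eqP; rewrite mulf_eq0 pnatr_eq0 /= => /eqP Q0.
apply/eqP; rewrite -subr_eq0 -sumrB; apply/eqP; rewrite -[RHS]Q0 /Q exchange_big.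
apply: eq_bigr => j _ /=; rewrite (bool_mul _ (b j)) (bool_mul _ (b' j)) -mulrBr /cut_form /mask /y /=.
case: (U j) => /=; first by rewrite mul0r big1 // => i _; rewrite mulr0.
rewrite /row_form -sumrB mulr_suml; apply: eq_bigr => i _; congr (_ * _).
by rewrite (bool_mul _ (a i)) (bool_mul _ (a' i)) -mulrBr /mask /x /=; case: (U i); rewrite ?mul0r ?mulr0.
Qed.

(** Exchanging the coordinates of [a] and [b] outside [U] permutes the pairs. *)
Lemma big_mix (U : bvec n) (F : bvec n -> nat) :
  (\sum_a \sum_b F (mix U a b) = 2 ^ n * \sum_a F a)%N.
Proof.
have -> : (2 ^ n * \sum_a F a = \sum_(a : bvec n) \sum_(b : bvec n) F a)%N.
  by rewrite exchange_big sum_nat_const card_bffun.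
rewrite !pair_big /=.
rewrite [RHS](reindex_inj (h := fun p => (mix U p.1 p.2, mix U p.2 p.1))) //=.
move=> [a b] [a' b'] /= [/ffunP E1 /ffunP E2]; congr (_, _); apply/ffunP => i.
  by have := E1 i; have := E2 i; rewrite !ffunE; case: (U i).
by have := E1 i; have := E2 i; rewrite !ffunE; case: (U i).
Qed.

(** For each [U], counting four-cycles turns density [N ^ - c] into [N ^ - (4 c)]; the sum over [U]
    gives [2 ^ n * (2 ^ n) ^ 4 = 8 ^ n * 4 ^ n]. *)
Lemma decoupling (N c : nat) (alpha : R) :
  (2 ^ n <= #|[set a | quad_form a == alpha]| * N ^ c)%N ->
  (8 ^ n * 4 ^ n <= (\sum_x collisions (cut_form A x)) * N ^ (4 * c))%N.
Proof.
set q := #|_| => le1.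
have le2 (U : bvec n) : (q ^ 4 <= \sum_(p : bvec n * bvec n) collisions (cut_form A (U, p)))%N.
  have := card_four_cycles (fun a b => quad_form (mix U a b) == alpha).
  rewrite (big_mix U (fun a => (quad_form a == alpha)%R : nat)) -card_set_sum -/q.
  rewrite card_bffun -expnD expnMn (_ : 2 + 2 = 4)%N //.
  rewrite leq_pmul2l ?expn_gt0 // => /leq_trans; apply.
  apply: leq_sum => -[a a'] _ /=; rewrite /collisions card_set_sum; apply: leq_sum => -[b b'] _ /=.
  case: and4P => [[/eqP h1 /eqP h2 /eqP h3 /eqP h4]|//].
  by rewrite (@four_cycle_collision U a a' b b') ?eqxx // h1 h2 h3 h4 !subrr.
have -> : (\sum_x collisions (cut_form A x) =
    \sum_(U : bvec n) \sum_(p : bvec n * bvec n) collisions (cut_form A (U, p)))%N.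
  by rewrite pair_big /=; apply: eq_bigr => -[].
apply: (@leq_trans ((2 ^ n * q ^ 4) * N ^ (4 * c))%N); last first.
  rewrite leq_mul2r -{1}card_bffun -sum_nat_const; apply/orP; right.
  by apply: leq_sum => U _; exact: le2.
rewrite -expnMn (_ : 8 * 4 = 2 * 2 ^ 4)%N // expnMn -mulnA leq_mul2l; apply/orP; right.
by rewrite expnAC [(4 * c)%N]mulnC [(N ^ _)%N]expnM -expnMn leq_exp2r.
Qed.

End Decoupling.

From mathcomp Require Import all_classical all_reals all_analysis.

Import numFieldNormedType.Exports.

Local Open Scope classical_set_scope.

(** * Generalized arithmetic progressions *)

Lemma card_gap_set_le (R : realType) r (Q : symgap R r) M :
  (forall h, (gap_bound Q h <= M)%N) -> (gap_set Q #<= `I_((2 * M).+1 ^ r)%N)%card.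
Proof.
move=> QM; pose F (f : {ffun 'I_r -> 'I_(2 * M).+1}) :=
  gap_eval Q (fun h => (f h : nat)%:Z - M%:Z).
pose G i := F (nth [ffun=> ord0] (enum {: {ffun 'I_r -> 'I_(2 * M).+1}}) i).
have sub : gap_set Q `<=` [set G i | i in `I_((2 * M).+1 ^ r)%N].
  move=> y [m mQ ->].
  have mlt h : (`|(m h + M%:Z)%R| < (2 * M).+1)%N.
    by have := mQ h; have := QM h; lia.
  pose f := [ffun h => Ordinal (mlt h)].
  exists (index f (enum {: {ffun 'I_r -> 'I_(2 * M).+1}})).
    rewrite /= (_ : (2 * M).+1 ^ r = size (enum {: {ffun 'I_r -> 'I_(2 * M).+1}}))%N.
      by rewrite index_mem mem_enum.
    by rewrite -cardE card_ffun !card_ord.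
  rewrite /G nth_index ?mem_enum // /F; apply: eq_bigr => h _; rewrite ffunE /=.
  congr (_%:~R * _); have := mQ h; have := QM h; lia.
exact: card_le_trans (subset_card_le sub) (card_image_le _ _).
Qed.

Lemma iter_sq_mono r M M' : (M <= M')%N ->
  (iter r (fun M => 4 * M ^ 2) M <= iter r (fun M => 4 * M ^ 2) M')%N.
Proof. by move=> le; elim: r => //= r IH; rewrite leq_mul2l leq_exp2r. Qed.

(* A coincidence between two representations is a nontrivial relation
   [\sum_h d h * g h = 0] with some [d h0 != 0]; dividing the other generators by
   [d h0] expresses everything with one generator fewer. *)
Lemma proper_gap_cover (R : realType) r (g : 'I_r -> R) M :
  exists r' (Q : symgap R r'),
    [/\ (r' <= r)%N, gap_proper Q,
        forall h, (gap_bound Q h <= iter r (fun M => 4 * M ^ 2) M.+1)%N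
      & forall m : 'I_r -> int, (forall h, (`|m h| <= M)%N) ->
          gap_set Q (\sum_(h < r) (m h)%:~R * g h)].
Proof.
have bump_ge r0 M1 : (M1 <= iter r0 (fun M => 4 * M ^ 2)%N M1)%N.
  by elim: r0 => //= r0 IH; apply: (leq_trans IH); nia.
elim: r g M => [|r IH] g M.
  exists 0%N, (SymGap g (fun=> M)); split=> //; first by move=> m m' _ _ _ [].
  by move=> m mM; exists m.
have [proper|nproper] := pselect (gap_proper (SymGap g (fun=> M))).
  exists r.+1, (SymGap g (fun=> M)); split=> //.
    by move=> h; apply: leq_trans (bump_ge _ _).
  by move=> m mM; exists m.
have [d [h0 [d0 dM dg]]] : exists (d : 'I_r.+1 -> int) h0,
    [/\ d h0 != 0, forall h, (`|d h| <= 2 * M)%N & \sum_h (d h)%:~R * g h = 0].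
  apply: contrapT => nex; apply: nproper => m m' mM m'M E h.
  apply/eqP; rewrite -subr_eq0; apply/negPn/negP => ne; apply: nex.
  exists (fun h => m h - m' h), h; split=> //.
    by move=> h'; have := mM h'; have := m'M h'; rewrite /=; lia.
  apply/eqP; under eq_bigr do rewrite rmorphB /= mulrBl.
  by rewrite sumrB subr_eq0; apply/eqP.
have d0R : (d h0)%:~R != 0 :> R by rewrite intr_eq0.
have [r' [Q [rr' Qp QM QE]]] := IH (fun h => g (lift h0 h) / (d h0)%:~R) (4 * M ^ 2)%N.
exists r', Q; split=> //; first exact: leqW.
  (* Starting at [M + 1] absorbs the successor, as [4 M ^ 2 + 1 <= 4 (M + 1) ^ 2]. *)
  move=> h; rewrite iterSr; apply: (leq_trans (QM h)); apply: iter_sq_mono; nia.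
move=> m mM; have -> : \sum_h (m h)%:~R * g h =
    \sum_h (m (lift h0 h) * d h0 - m h0 * d (lift h0 h))%:~R *
           (g (lift h0 h) / (d h0)%:~R).
  rewrite (bigD1_ord h0) //= in dg; rewrite (bigD1_ord h0) //=.
  have -> : g h0 = - \sum_h (d (lift h0 h))%:~R * g (lift h0 h) / (d h0)%:~R.
    rewrite -mulr_suml; apply: (mulIf d0R); rewrite mulNr divfK // mulrC.
    by apply/eqP; rewrite -addr_eq0 dg.
  rewrite mulrN mulr_sumr addrC -sumrB; apply: eq_bigr => h _.
  rewrite rmorphB !rmorphM /= mulrBl; congr (_ - _); last by rewrite !mulrA.
  by rewrite mulrACA divff // mulr1.
apply: QE => h; have := mM h0; have := mM (lift h0 h); have := dM h0; have := dM (lift h0 h).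
move: (m h0) (m (lift h0 h)) (d h0) (d (lift h0 h)) => a b c e ce cc bb aa.
have : (`|(b * c - a * e)%R| <= `|b| * `|c| + `|a| * `|e|)%N.
  by rewrite -!abszM; lia.
by move=> /leq_trans; apply; nia.
Qed.

(** The induction carries a factor [N ^ 2], which absorbs the 4 at each squaring. *)
Lemma iter_sq_le N x r : (2 <= N)%N ->
  (iter r (fun M => 4 * M ^ 2) (N ^ x) <= N ^ (2 ^ r * (x + 2)))%N.
Proof.
move=> N2; suff : (N ^ 2 * iter r (fun M => 4 * M ^ 2) (N ^ x) <= N ^ (2 ^ r * (x + 2)))%N.
  by apply: leq_trans; rewrite leq_pmull // expn_gt0 (ltnW N2).
elim: r => [|r IH] /=; first by rewrite mul1n -expnD addnC.
have -> : (2 ^ r.+1 * (x + 2) = 2 ^ r * (x + 2) * 2)%N by rewrite expnS -mulnA mulnC.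
rewrite [leqRHS]expnM; move: IH; set y := iter _ _ _; set z := (N ^ (_ * _))%N => yz.
apply: (@leq_trans ((N ^ 2 * y) ^ 2)%N); last by rewrite leq_exp2r.
rewrite [leqRHS]expnMn mulnA leq_mul2r -[X in (_ <= X)%N]mulnn leq_mul2l.
by rewrite (_ : 4 = 2 ^ 2)%N // leq_exp2r // N2 !orbT.
Qed.

Lemma gap_cover (R : realType) N x r (g : 'I_r -> R) : (2 <= N)%N ->
  exists r' (Q : symgap R r'),
    [/\ (r' <= r)%N, gap_proper Q,
        (gap_set Q #<= `I_(N ^ ((2 ^ r * (x + 3) + 2) * r))%N)%card
      & forall m : 'I_r -> int, (forall h, (`|m h| <= N ^ x)%N) ->
          gap_set Q (\sum_(h < r) (m h)%:~R * g h)].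
Proof.
move=> N2; have [r' [Q [rr' Qp Qb QE]]] := proper_gap_cover g (N ^ x).
have N0 : (0 < N)%N by apply: leq_trans N2.
have leM h : (gap_bound Q h <= N ^ (2 ^ r * (x + 3)))%N.
  apply: leq_trans (Qb h) _; rewrite -[3%N]/(1 + 2)%N addnA.
  apply: leq_trans (iter_sq_le (x + 1) r N2); apply: iter_sq_mono.
  by rewrite expnD expn1; have := expn_gt0 N x; rewrite N0; nia.
exists r', Q; split=> //; apply: card_le_trans (card_gap_set_le leM) _.
rewrite card_le_II.
set y := (2 ^ r * (x + 3))%N.
have le2 : ((2 * N ^ y).+1 <= N ^ (y + 2))%N.
  by rewrite expnD; have := expn_gt0 N y; rewrite N0; nia.
apply: (@leq_trans ((N ^ (y + 2)) ^ r')%N); first by case: (r') => // k; rewrite leq_exp2r.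
by rewrite -expnM leq_pexp2l // leq_mul2l rr' orbT.
Qed.

(** * Rademacher variables *)

Section Rademacher.
Variables (R : realType) (d : measure_display) (T : measurableType d)
  (P : probability T R) (n : nat) (x : 'I_n -> {RV P >-> R}).
Hypotheses (x_indep : mutually_independent x) (x_rad : forall i, rademacher (x i)).

Let atom (a : bvec n) : set T := \bigcap_(i in [set` [set: 'I_n]%SET]) (x i @^-1` [set sgn R (a i)]).

Let atomP a t : atom a t <-> forall i, x i t = sgn R (a i).
Proof.
split=> [at_ i|xt i _]; last exact: xt.
by apply: at_ => /=; rewrite inE.
Qed.

Let measurable_atom a : measurable (atom a).
Proof.
apply: fin_bigcap_measurable => [|i _]; first exact: finite_finset.
by rewrite -[X in measurable X]setTI; apply: measurable_funP => //; apply: measurable_set1.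
Qed.

Let P_atom a : P (atom a) = ((2^-1) ^+ n)%:E.
Proof.
rewrite /atom (@x_indep [set: 'I_n]%SET (fun i => [set sgn R (a i)])); last first.
  by move=> i; apply: measurable_set1.
under eq_bigr => i _.
  have -> : P (x i @^-1` [set sgn R (a i)]) = (2^-1 : R)%:E.
    have [h1 h2] := x_rad i.
    by case: (a i); rewrite /sgn; [exact: h1 | exact: h2].
  over.
rewrite (eq_bigl xpredT); last by move=> i; rewrite inE.
by rewrite prodEFin prodr_const card_ord.
Qed.

Let union_atoms (s : seq (bvec n)) := \big[setU/set0]_(a <- s) atom a.

Let union_atomsP s t : union_atoms s t <-> exists2 a, a \in s & atom a t.
Proof.
rewrite /union_atoms -bigcup_seq; split=> [[a /= as_ at_]|[a as_ at_]]; by exists a.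
Qed.

Let sgn_inj : injective (sgn R).
Proof. by move=> [] [] //= /eqP; rewrite /sgn ?eqNr ?[_ == - _]eq_sym ?eqNr oner_eq0. Qed.

Let measurable_union_atoms s : measurable (union_atoms s).
Proof. by apply: bigsetU_measurable => a _; apply: measurable_atom. Qed.

Let P_union_atoms s : uniq s -> P (union_atoms s) = ((size s)%:R * (2^-1) ^+ n)%:E.
Proof.
elim: s => [|a s IH] /=; first by rewrite /union_atoms big_nil measure0 mul0r.
case/andP=> a_s uniq_s; rewrite /union_atoms big_cons measureU //.
- transitivity (((2^-1) ^+ n)%:E + ((size s)%:R * (2^-1) ^+ n)%:E : \bar R)%E.
    by congr (_ + _)%E; [exact: P_atom | exact: IH].
  by rewrite -EFinD -[(size s).+1]addn1 natrD mulrDl mul1r addrC.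
- exact: measurable_union_atoms.
rewrite -subset0 => t [/atomP at_ /union_atomsP [b bs /atomP bt]].
suff ab : a = b by rewrite ab bs in a_s.
by apply/ffunP => i; apply: sgn_inj; rewrite -at_ -bt.
Qed.

Lemma prob_quad_form_le (A : 'M[R]_n) (alpha : R) :
  (P [set t | (\sum_(i < n) \sum_(j < n) A i j * x i t * x j t)%R = alpha] <=
   (#|[set a | quad_form (fun i j => A i j) a == alpha]%SET|%:R * (2^-1) ^+ n)%R%:E)%E.
Proof.
set S := [set a | _]%SET; set E := [set t | _].
have mE : measurable E.
  have mf : measurable_fun setT (fun t => \sum_(i < n) \sum_(j < n) A i j * x i t * x j t).
    apply: measurable_sum => i; apply: measurable_sum => j.
    by apply: measurable_realfun.measurable_funM => //; apply: measurable_realfun.measurable_funM.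
  by have := mf measurableT [set alpha] (measurable_set1 _); rewrite setTI.
pose V := union_atoms (enum {: bvec n}).
(* The atoms have total mass 1, so values other than 1 and -1 occur only on a null set. *)
have PV0 : P (~` V) = 0%E.
  rewrite probability_setC; last exact: measurable_union_atoms.
  rewrite P_union_atoms ?enum_uniq // -cardE card_bffun natrX -exprMn divff ?pnatr_eq0 //.
  by rewrite expr1n subee.
have sub : E `<=` union_atoms (enum S) `|` ~` V.
  move=> t Et; have [Vt|] := pselect (V t); last by right.
  left; have /union_atomsP [a _ at_] := Vt; apply/union_atomsP; exists a => //.
  rewrite mem_enum inE; apply/eqP; rewrite -[RHS]Et.
  by apply: eq_bigr => i _; apply: eq_bigr => j _; rewrite !((atomP a t).1 at_).
rewrite cardE -P_union_atoms ?enum_uniq //.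
have mV : measurable (~` V) by apply: measurableC; apply: measurable_union_atoms.
rewrite -(measureU0 (measurable_union_atoms (enum S)) mV PV0).
by apply: le_measure => //; rewrite inE //; apply: measurableU => //; apply: measurable_union_atoms.
Qed.

Lemma rho_q_count (A : 'M[R]_n) (C : R) c : (2 <= n)%N -> C + 1 <= c%:R ->
  ((n%:R `^ (- C))%:E <= rho_q x A)%E ->
  exists alpha, (2 ^ n <= #|[set a | quad_form (fun i j => A i j) a == alpha]%SET| * n ^ c)%N.
Proof.
move=> n2 Cc rho; have n0 : 0 < n%:R :> R by rewrite ltr0n (leq_trans _ n2).
(* A strict inequality is needed to pick [alpha], as the supremum is approached rather than assumed
   attained. *)
have lt_rho : ((n%:R `^ (- c%:R))%:E < rho_q x A)%E.
  apply: lt_le_trans rho; rewrite lte_fin.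
  rewrite /powR gt_eqF // ltr_expR ltr_pM2r; last by rewrite ln_gt0 // ltr1n.
  by rewrite ltrN2 (lt_le_trans _ Cc) // ltrDl.
have [_ [alpha _ <-] lt_alpha] := ereal_sup_gt lt_rho.
exists alpha.
have := lt_le_trans lt_alpha (prob_quad_form_le A alpha).
rewrite lte_fin powR_invn ?ler0n // exprVn => lt1.
rewrite -(ler_nat R) natrM !natrX.
rewrite -ler_pdivrMr ?exprn_gt0 // -ler_pdivlMl ?exprn_gt0 //.
by rewrite mulrC in lt1; apply: ltW.
Qed.

End Rademacher.

(** * The row operation *)

Section RowOperation.
Variables (R : realType) (n k D : nat) (g : 'I_k -> 'I_n) (q : 'I_n -> 'I_k -> int)
  (I : {set 'I_n}).
Let I0 := [set g h | h : 'I_k]%SET.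
(** The sum handles a [g] that is not injective. *)
Definition relation_coef (i i0 : 'I_n) : int := - \sum_(h | g h == i0) q i h.

Lemma relation_coef_le L i i0 : (forall i h, i \in I -> (`|q i h| <= L)%N) -> i \in I ->
  (`|relation_coef i i0| <= k * L)%N.
Proof.
move=> qL iI; rewrite /relation_coef abszN.
apply: (@leq_trans (\sum_(h | g h == i0) L)%N).
  elim/big_ind2: _ => // [a b c d ab cd|h _]; last exact: qL.
  by apply: leq_trans (leq_add ab cd); lia.
by rewrite sum_nat_const leq_mul2r -[k in leqRHS]card_ord max_card orbT.
Qed.

Hypothesis I_I0 : [disjoint I & I0]%B.

Lemma sum_row_op (v : 'I_n -> R) j :
  \sum_t v t * row_op_mx R I I0 D%:Z relation_coef j t =
  if j \in I then v j *+ D - \sum_h v (g h) *~ q j h else v j.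
Proof.
case: ifPn => jI; last first.
  rewrite (bigD1 j) //= mxE (negbTE jI) eqxx mulr1 big1 ?addr0 // => t tj.
  by rewrite mxE (negbTE jI) (negbTE tj) mulr0.
rewrite (bigID (mem I0)) /= addrC; congr (_ + _).
  have jI0 : j \notin I0 by rewrite (disjointFr I_I0 jI).
  rewrite (bigD1 j) //= mxE jI (negbTE jI0) eqxx big1 ?addr0.
    by rewrite pmulrn mulrzr.
  by move=> t /andP [tI0 tj]; rewrite mxE jI (negbTE tI0) (negbTE tj) mulr0.
rewrite (partition_big g (mem I0)) /=; last by move=> h _; apply: imset_f.
rewrite -sumrN; apply: eq_bigr => t tI0; rewrite mxE jI tI0 /relation_coef.
rewrite rmorphN mulrN /= mulrzr mulrz_sumr; congr (- _).
by apply: eq_bigr => h /eqP ->.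
Qed.

End RowOperation.

(** * Choice of scale and final assembly *)

Lemma affine_le_exp a b : exists l0, forall l, (l0 <= l)%N -> (a * l + b <= 2 ^ l)%N.
Proof.
exists (4 * (a + b))%N => l ll.
have h1 : (l./2.+1 <= 2 ^ l./2)%N by exact: ltn_expl.
have h2 : (2 * (a + b) <= 2 ^ l./2)%N.
  apply: leq_trans (ltnW (ltn_expl (2 * (a + b)) (isT : 1 < 2)%N)) _.
  by rewrite leq_exp2l //; lia.
apply: (@leq_trans ((2 * (a + b)) * l./2.+1)%N); first by have := odd_double_half l; nia.
apply: (leq_trans (leq_mul h2 h1)); rewrite -expnD leq_exp2l //.
by have := odd_double_half l; lia.
Qed.

Lemma loss_le l a w b :
  (3 * (loss l a + (l * w + 1)) + 2 + b <= ((6 * a + 3 * w) * l + (8 + b)) * 2 ^ l)%N.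
Proof.
rewrite /loss; move: (2 ^ l)%N (expn_gt0 2 l) => M /= M0.
have := leq_pmulr (l * w) M0; have := leq_pmulr b M0; lia.
Qed.

Lemma masked_loss_le l e a (z := (6 * a + 3 * (a + (e * (2 * a) + (4 * a + 2))))%N) :
  (masked_loss l e a <= (z * l + 8) * 2 ^ l)%N.
Proof.
rewrite /masked_loss /z; move: (_ + (_ + _))%N => w.
apply: leq_trans (loss_le l a w 0).
by rewrite addn0 leq_add2r leq_mul2l leq_add2l addn1 leqnSn.
Qed.

(** One progression must hold both the entries that the column operation leaves alone and those it
    changes; so the generators are the [w (g' h) / D'] together with the [w (g h)]. *)
Lemma commensurable_cover (R : realType) (n k k' N L D D' : nat) (g : 'I_k -> 'I_n)
    (g' : 'I_k' -> 'I_n) (w : 'I_n -> R) x :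
  (2 <= N)%N -> (0 < D' )%N -> (D * L <= N ^ x)%N -> (L <= N ^ x)%N ->
  exists r (Q : symgap R r),
    [/\ (r <= k' + k)%N, gap_proper Q,
        (gap_set Q #<= `I_(N ^ ((2 ^ (k' + k) * (x + 3) + 2) * (k' + k)))%N)%card
      & forall j (q : 'I_k -> int), commensurable L D' g' w j ->
          (forall h, (`|q h| <= N ^ x)%N) ->
          gap_set Q (w j) /\ gap_set Q (w j *+ D - \sum_h w (g h) *~ q h)].
Proof.
move=> N2 D'0 DL LN; pose G (h : 'I_(k' + k)) : R :=
  match fintype.split h with inl h => w (g' h) / D'%:R | inr h => w (g h) end.
have [r [Q [rk Qp Qc QE]]] := gap_cover x G N2.
exists r, Q; split=> // j q [m mL mE] qN.
have D'R : D'%:R != 0 :> R by rewrite pnatr_eq0 -lt0n.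
have wE : w j = \sum_h (m h)%:~R * (w (g' h) / D'%:R).
  apply: (mulIf D'R); rewrite mulr_natr mE mulr_suml; apply: eq_bigr => h _.
  by rewrite mulrA divfK // mulrzl.
have cover (E : nat) (p : 'I_k -> int) : (E * L <= N ^ x)%N -> (forall h, (`|p h| <= N ^ x)%N) ->
    gap_set Q (w j *+ E - \sum_h w (g h) *~ p h).
  move=> EL pN.
  pose M (h : 'I_(k' + k)) : int :=
    match fintype.split h with inl h => m h * E%:Z | inr h => - p h end.
  have -> : w j *+ E - \sum_h w (g h) *~ p h = \sum_h (M h)%:~R * G h.
    rewrite big_split_ord /=; congr (_ + _).
      rewrite wE -sumrMnl; apply: eq_bigr => h _; rewrite /M /G.
      case: splitP => [h' /= /ord_inj <-|h' /= e]; last by have := ltn_ord h; lia.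
      by rewrite rmorphM /= mulrAC mulr_natr.
    rewrite -sumrN; apply: eq_bigr => h _; rewrite /M /G.
    case: splitP => [h' /= e|h' /= /addnI /ord_inj <-]; first by have := ltn_ord h'; lia.
    by rewrite rmorphN mulNr mulrzl.
  apply: QE => h; rewrite /M; case: (fintype.split h) => h'; last by rewrite abszN.
  by rewrite abszM absz_nat mulnC (leq_trans _ EL) // leq_mul2l mL orbT.
split; last exact: cover.
have := cover 1%N (fun=> 0); rewrite mul1n => /(_ LN) /(_ (fun=> leq0n _)).
by rewrite big1 ?subr0 // => h _; rewrite mulr0z.
Qed.

Lemma card_setC_ge n (S : {set 'I_n}) (R : realType) (y : R) : #|S|%:R <= y ->
  n%:R - y <= #|~: S|%:R.
Proof.
move=> Sy; rewrite lerBlDr (le_trans _ (lerD (lexx _) Sy)) // -natrD.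
by rewrite [(_ + #|S|)%N]addnC cardsC card_ord.
Qed.

(** [N = 2 ^ l] satisfies [N ^ e <= n], whence [N ^ 2 <= n ^ eps]; and [log n < (l + 1) e <= 2 l e]
    makes [n] polynomial in [N]. *)
Lemma dyadic_scale (R : realType) (eps : R) e n (l := (trunc_log 2 n %/ e)%N) :
  0 < eps -> 2 <= e%:R * eps -> (0 < n)%N -> (0 < l)%N ->
  [/\ (n <= 2 ^ (l * (2 * e)))%N, (2 ^ l <= n)%N & ((2 ^ l) ^ 2)%:R <= n%:R `^ eps].
Proof.
move=> eps0 eeps n0 l0.
have e0 : (0 < e)%N.
  by rewrite lt0n; apply: contraTneq eeps => ->; rewrite mul0r -ltNge.
have le_n : ((2 ^ l) ^ e <= n)%N.
  rewrite -expnM; apply: leq_trans (trunc_logP (isT : 1 < 2)%N n0).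
  by rewrite leq_exp2l // leq_divM.
split.
- apply: ltnW; apply: leq_trans (trunc_log_ltn n (isT : 1 < 2)%N) _.
  rewrite leq_exp2l //; apply: leq_trans (ltn_ceil (trunc_log 2 n) e0) _.
  by rewrite mulnA leq_mul2r; apply/orP; right; rewrite -/l; lia.
- by apply: leq_trans le_n; rewrite -{1}(expn1 (2 ^ l)) leq_pexp2l // expn_gt0.
rewrite natrX -powR_mulrn //.
apply: (@le_trans _ _ ((2 ^ l)%:R `^ (e%:R * eps))).
  by apply: ler_powR => //; rewrite ler1n expn_gt0.
rewrite powRrM powR_mulrn // -natrX.
by apply: ge0_ler_powR; rewrite ?nnegrE ?ler_nat // ltW.
Qed.

Theorem theorem8p6 (R : realType) (eps C : R)
    (eps_gt0 : 0 < eps) (eps_le1 : eps <= 1) (C_gt0 : 0 < C) :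
  exists K n0 : nat,
  forall (n : nat), (n0 <= n)%N ->
  forall (d : measure_display) (T : measurableType d) (P : probability T R)
    (x : 'I_n -> {RV P >-> R}),
    mutually_independent x -> (forall i, rademacher (x i)) ->
  forall A : 'M[R]_n, A^T = A ->
    ((n%:R `^ (- C))%:E <= rho_q x A)%E ->
  exists (I0 I : {set 'I_n}) (k : int) (kc : 'I_n -> 'I_n -> int),
    [/\ (#|I0| <= K)%N,
        n%:R - 2 * n%:R `^ eps <= #|I|%:R :> R,
        [disjoint I & I0]%B,
        [/\ k != 0, (`|k| <= n ^ K)%N
          & forall i i0, i \in I -> i0 \in I0 -> (`|kc i i0| <= n ^ K)%N]
      & let A' := row_op_mx R I I0 k kc *m A *m (row_op_mx R I I0 k kc)^T in
        (forall i, i \in I -> mostly_in_gap eps K (fun j => A' i j)) /\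
        (forall j, j \in I -> mostly_in_gap eps K (fun i => A' i j))].
Proof.
pose e := (Num.bound (2 / eps)).
have eeps : 2 <= e%:R * eps.
  rewrite -ler_pdivrMr // ltW //; apply: archi_boundP.
  by rewrite divr_ge0 // ltW.
pose c0 := Num.bound (C + 1).
have Cc0 : C + 1 <= c0%:R.
  by rewrite ltW //; apply: archi_boundP; rewrite addr_ge0 // ltW.
(* Passing from powers of [n] to powers of [N] multiplies exponents by [ee]; decoupling multiplies
   them by 4. *)
pose ee := (2 * e)%N; pose c := (4 * (ee * c0))%N; pose c1 := c.+1.
pose k := (2 * c1)%N.
pose r2 := (c1 + (ee * k + (4 * c1 + 2)))%N.
pose r3 := (ee + r2 + (k * (4 * c1 + 5)) + 1)%N.
pose c' := r3.+1; pose k' := (2 * c')%N.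
(* [N ^ y] bounds the first denominator times a coefficient from the second application of the
   linear theorem. *)
pose y := ((4 * c1 + 1) + (4 * c' + 3))%N.
pose size_exp := ((2 ^ (k' + k) * (y + 3) + 2) * (k' + k))%N.
pose K := (k' + k + size_exp + (4 * c1 + 1) + (k + (4 * c1 + 3)))%N.
have [kK size_K DK coefK] : [/\ k <= K, size_exp <= K, 4 * c1 + 1 <= K
    & k + (4 * c1 + 3) <= K]%N.
  have le_sum a b f u v : [/\ u <= v + u + f + a + b, f <= v + u + f + a + b,
      a <= v + u + f + a + b & b <= v + u + f + a + b]%N by clear; split; lia.
  exact: le_sum.
have y_ge : (4 * c1 + 3 <= y)%N by rewrite /y -addnA leq_add2l addnA leq_addl.
have [l1 l1P] := affine_le_exp (6 * c1 + 3 * r2) (8 + k).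
have [l2 l2P] := affine_le_exp (6 * c' + 3 * (c' + (ee * (2 * c') + (4 * c' + 2)))) 8.
pose l0 := (l1 + l2 + 1)%N.
exists K, (2 ^ (l0 * e))%N => n n_ge d T P x x_indep x_rad A A_sym rho.
have e0 : (0 < e)%N.
  by rewrite lt0n; apply: contraTneq eeps => ->; rewrite mul0r -ltNge.
have n_gt1 : (2 <= n)%N.
  apply: leq_trans n_ge; rewrite -{1}(expn1 2) leq_exp2l // muln_gt0 e0 andbT.
  by rewrite /l0 addn1.
have n_gt0 : (0 < n)%N by apply: leq_trans n_gt1.
pose l := (trunc_log 2 n %/ e)%N; pose N := (2 ^ l)%N.
have l_ge : (l0 <= l)%N by rewrite leq_divRL //; apply: trunc_log_max.
have l_gt0 : (0 < l)%N by apply: leq_trans l_ge; rewrite /l0 addn1.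
have [nN Nn N_eps] := dyadic_scale eps_gt0 eeps n_gt0 l_gt0.
rewrite -/l -/N -/ee in nN Nn N_eps.
have N_gt1 : (2 <= N)%N by rewrite /N -{1}(expn1 2) leq_exp2l.
have N_gt0 : (0 < N)%N by apply: leq_trans N_gt1.
(* The extra [k] pays for removing [I0] along with [B]. *)
have loss1 : (3 * (loss l c1 + (l * r2 + 1)) + 2 + k <= N ^ 2)%N.
  apply: (@leq_trans (((6 * c1 + 3 * r2) * l + (8 + k)) * N)%N).
    exact: loss_le.
  by rewrite -mulnn leq_mul2r l1P ?orbT // (leq_trans _ l_ge) // /l0 -addnA leq_addr.
have loss2 : (masked_loss l ee c' <= N ^ 2)%N.
  set z := (6 * c' + _)%N in l2P.
  apply: (@leq_trans ((z * l + 8) * N)%N).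
    exact: masked_loss_le.
  by rewrite -mulnn leq_mul2r l2P ?orbT // (leq_trans _ l_ge) // /l0 addnAC leq_addl.
have NK a : (a <= K)%N -> (N ^ a <= n ^ K)%N.
  move=> aK; apply: (@leq_trans (N ^ K)%N); first by rewrite leq_pexp2l.
  by rewrite leq_exp2r // /K !addnS.
have [alpha count] := rho_q_count x_indep x_rad n_gt1 Cc0 rho.
have A_symE i j : A i j = A j i by rewrite -{1}A_sym mxE.
have {}count : (2 ^ n <= #|[set a | quad_form (fun i j => A i j) a == alpha]%SET| *
    N ^ (ee * c0))%N.
  apply: (leq_trans count); rewrite leq_mul2l; apply/orP; right.
  have -> : (N ^ (ee * c0) = (2 ^ (l * ee)) ^ c0)%N by rewrite /N -!expnM mulnA.
  by case: (c0) => // c0'; rewrite leq_exp2r.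
have [g [D [B [/andP [D_gt0 leD] leB relB]]]] :=
  rows_commensurable n_gt0 l_gt0 nN (decoupling A_symE count).
rewrite -/c -/c1 -/k -/r2 -/r3 in leD leB relB.
pose I0 := [set g h | h : 'I_k]%SET.
have leI0 : (#|I0| <= k)%N by rewrite -[k in leqRHS]card_ord leq_imset_card.
pose I := (~: (B :|: I0))%SET.
have I_I0 : [disjoint I & I0]%B.
  rewrite disjoint_subset; apply/fintype.subsetP => i.
  by rewrite !inE negb_or => /andP [].
pose relates j (qj : 'I_k -> int) :=
  (forall h, (`|qj h| <= N ^ (4 * c1 + 3))%N) /\
  (8 ^ n <= masked_collisions
     (fun i => A i j *+ D - \sum_(h < k) A i (g h) *~ qj h)%R * N ^ r3)%N.
have rel_ex j : exists qj, j \in I -> relates j qj.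
  have [jI|njI] := boolP (j \in I); last by exists (fun=> 0).
  have [|qj qjP] := relB j; last by exists qj.
  by move: jI; rewrite !inE negb_or => /andP [].
have [q qP] := boolp.choice rel_ex.
exists I0, I, D%:Z, (relation_coef g q).
have qL : forall i h, i \in I -> (`|q i h| <= N ^ (4 * c1 + 3))%N by move=> i h /qP [].
set Rm := row_op_mx _ _ _ _ _; set A' := (Rm *m A *m Rm^T).
have A'_sym : A'^T = A' by rewrite /A' !trmx_mul trmxK A_sym mulmxA.
have rowsA' : forall i, i \in I -> mostly_in_gap eps K (fun j => A' i j).
  (* [w] is row [i] of [Rm *m A]. Multiplying by [Rm^T] then only combines its entry at [j] with
     those at the [g h]. *)
  move=> i iI; pose w (t : 'I_n) : R := A t i *+ D - \sum_(h < k) A t (g h) *~ q i h.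
  have [g' [D' [/andP [D'_gt0 leD'] bad]]] :=
    masked_littlewood_offord (w := w) n_gt0 l_gt0 nN (qP i iI).2.
  have RmA t : (Rm *m A) i t = w t.
    rewrite mxE; under eq_bigr do rewrite mulrC.
    by rewrite (sum_row_op D q I_I0 (fun s => A s t)) iI A_symE; congr (_ - _);
       apply: eq_bigr => h _; rewrite A_symE.
  have A'E j : A' i j = if j \in I then w j *+ D - \sum_h w (g h) *~ q j h else w j.
    rewrite /A' mxE -(sum_row_op D q I_I0 w j).
    by apply: eq_bigr => t _; rewrite RmA mxE.
  have [||r [Q [rk Qp Qc QE]]] := @commensurable_cover R n k k' N (N ^ (4 * c' + 3)) D D' g g' w y
     N_gt1 D'_gt0.
  - by rewrite /y [leqRHS]expnD; exact: (leq_mul leD (leqnn _)).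
  - by rewrite leq_pexp2l // leq_addl.
  exists (~: incommensurable (N ^ (4 * c' + 3)) D' g' w), r, Q; split=> //.
  - by apply: card_setC_ge; apply: le_trans N_eps; rewrite ler_nat (leq_trans bad).
  - by apply: (leq_trans rk); rewrite /K -!addnA leq_add2l leq_addr.
  - apply: card_le_trans Qc _; rewrite card_le_II; apply: NK.
    exact: size_K.
  move=> j; rewrite !inE negbK => /asboolP cj; rewrite A'E; case: ifP => jI.
    apply: (QE j (q j) cj _).2 => h; apply: (leq_trans (qL j h jI)).
    by rewrite leq_pexp2l.
  by apply: (QE j (fun=> 0) cj _).1.
split=> //.
- exact: leq_trans leI0 kK.
- apply: card_setC_ge; apply: (@le_trans _ _ (n%:R `^ eps)); last first.
    by rewrite ler_peMl ?powR_ge0 // ler1n.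
  apply: le_trans N_eps; rewrite ler_nat; apply: leq_trans loss1.
  by apply: (leq_trans (leq_card_setU _ _)); rewrite leq_add.
- split; first by rewrite -lt0n in D_gt0 *.
    by apply: (leq_trans leD); apply: NK.
  move=> i i0 iI _; have le_coef := @relation_coef_le _ _ g q I _ i i0 qL iI; apply: (leq_trans le_coef).
  apply: (@leq_trans (N ^ (k + (4 * c1 + 3)))%N); last by apply: NK.
  by rewrite (expnD N k); apply: leq_mul => //; apply: ltnW; apply: ltn_expl.
split=> // j jI; rewrite (_ : (fun i => A' i j) = (fun i => A' j i)); first exact: rowsA'.
by apply/funext => i; rewrite -{1}A'_sym mxE.
Qed.
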